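(* Let $k$ be an algebraically closed field of characteristic zero and let $A$ be a simple abelian variety over $k$. Then every nontrivial (i.e. not identically zero) algebraic vector field on $A$ is wild.
   Context: An algebraic vector field on a variety $X$ over $k$ is a global regular section $v:X\to TX$ of the tangent space, equivalently a $k$-linear derivation of $\mathcal{O}_X$. A Zariski closed subset $Y\subseteq X$ (with reduced structure, possibly reducible) is invariant for $(X,v)$ if $v|_Y$ maps $Y$ into $TY$; equivalently, the ideal sheaf of $Y$ is preserved by the derivation. The vector field $v$ is wild if there is no nonempty closed subset $Y\subsetneq X$ that is invariant for $(X,v)$. *)

(* Defs.v *)
(* Varieties over an algebraically closed field k are set up in the classical
   language of Serre and Kempf: a variety is the space of its closed points
   together with the sheaf of k-valued regular functions.  Since k is
   algebraically closed and varieties are reduced, this is equivalent to the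
   language of reduced separated schemes of finite type over k. *)
From HB Require Import structures.
From mathcomp Require Import all_boot all_order all_algebra.
From mathcomp Require Import all_classical all_reals topology.
From mathcomp Require mpoly.
Import (canonicals) mpoly.

Set Implicit Arguments.
Unset Strict Implicit.
Unset Printing Implicit Defensive.

Import GRing.Theory.

Local Open Scope classical_set_scope.
Local Open Scope ring_scope.

(* [regular_on U f] says that f restricts to a section over U of the structure
   sheaf; the values of f outside U are irrelevant.  It is only meaningful for
   open U. *)
HB.mixin Record hasRegularFunctions (k : closedFieldType) (X : Type)
    & Topological X := {
  regular_on : set X -> set (X -> k);
  regular_on_ext : forall (U : set X) (f g : X -> k), open U ->
    (forall x, U x -> f x = g x) -> regular_on U f -> regular_on U g;
  regular_on_sub : forall (U V : set X) (f : X -> k), open U -> open V ->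
    V `<=` U -> regular_on U f -> regular_on V f;
  regular_on_local : forall (U : set X) (f : X -> k), open U ->
    (forall x, U x -> exists V : set X,
      [/\ open V, V x, V `<=` U & regular_on V f]) ->
    regular_on U f;
  regular_on_cst : forall (U : set X) (c : k), open U ->
    regular_on U (fun=> c);
  regular_onD : forall (U : set X) (f g : X -> k), open U ->
    regular_on U f -> regular_on U g -> regular_on U (fun x => f x + g x);
  regular_onM : forall (U : set X) (f g : X -> k), open U ->
    regular_on U f -> regular_on U g -> regular_on U (fun x => f x * g x);
  open_regular_neq0 : forall (U : set X) (f : X -> k), open U ->
    regular_on U f -> open [set x | U x /\ f x != 0];
  regular_onV : forall (U : set X) (f : X -> k), open U ->
    regular_on U f ->
    regular_on [set x | U x /\ f x != 0] (fun x => (f x)^-1)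
}.

#[short(type="spaceWithFunctions")]
HB.structure Definition SpaceWithFunctions (k : closedFieldType) :=
  {X of Topological X & hasRegularFunctions k X}.

Definition regular_map (k : closedFieldType) (X Y : spaceWithFunctions k)
    (f : X -> Y) : Prop :=
  continuous f /\
  forall (V : set Y) (g : Y -> k), open V -> regular_on V g ->
    regular_on (f @^-1` V) (g \o f).

Definition isomorphic (k : closedFieldType) (X Y : spaceWithFunctions k) : Prop :=
  exists (f : X -> Y) (g : Y -> X),
    [/\ regular_map f, regular_map g, cancel f g & cancel g f].

(* Affine n-space with its Zariski topology. *)
Definition affine_space (k : closedFieldType) (n : nat) : Type := 'rV[k]_n.

Section AffineSpace.
Variables (k : closedFieldType) (n : nat).
Local Notation An := (affine_space k n).

Definition poly_eval (p : mpoly.mpoly n k) (x : An) : k :=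
  mpoly.meval (fun i => (x : 'rV[k]_n) ord0 i) p.

Definition zariski_open (W : set An) : Prop :=
  forall x, W x -> exists p : mpoly.mpoly n k,
    poly_eval p x != 0 /\ [set y | poly_eval p y != 0] `<=` W.

Definition locally_rational (W : set An) (f : An -> k) : Prop :=
  forall x, W x -> exists p q : mpoly.mpoly n k, poly_eval q x != 0 /\
    forall y, W y -> poly_eval q y != 0 -> f y = poly_eval p y / poly_eval q y.

Fact poly_evalD (p q : mpoly.mpoly n k) x : poly_eval (p + q) x = poly_eval p x + poly_eval q x.
Proof. exact: rmorphD. Qed.

Fact poly_evalM (p q : mpoly.mpoly n k) x : poly_eval (p * q) x = poly_eval p x * poly_eval q x.
Proof. exact: rmorphM. Qed.

Fact poly_eval1 x : poly_eval 1 x = 1.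
Proof. exact: rmorph1. Qed.

Fact poly_evalC c x : poly_eval (mpoly.mpolyC n c) x = c.
Proof. exact: mpoly.mevalC. Qed.

Fact zariski_openT : zariski_open setT.
Proof. by move=> x _; exists 1; rewrite poly_eval1 oner_neq0. Qed.

Fact zariski_openI : setI_closed zariski_open.
Proof.
move=> A B oA oB x [/oA[p [px pA]] /oB[q [qx qB]]].
exists (p * q); rewrite poly_evalM mulf_neq0//; split=> // y /=.
by rewrite poly_evalM mulf_eq0 negb_or => /andP[? ?]; split; [exact: pA|exact: qB].
Qed.

Fact zariski_open_bigU (I : Type) (F : I -> set An) :
  (forall i, zariski_open (F i)) -> zariski_open (\bigcup_i F i).
Proof.
move=> oF x [i _ /oF[p [px pF]]]; exists p; split=> // y /pF Fy.
by exists i.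
Qed.

HB.instance Definition _ := Choice.on An.
HB.instance Definition _ :=
  isOpenTopological.Build An zariski_openT zariski_openI zariski_open_bigU.

Lemma affine_space_openE : @open An = zariski_open.
Proof. by []. Qed.

Fact locally_rational_ext (U : set An) (f g : An -> k) : open U ->
  (forall x, U x -> f x = g x) -> locally_rational U f -> locally_rational U g.
Proof.
move=> _ fg rf x Ux; have [p [q [qx e]]] := rf x Ux.
by exists p, q; split=> // y Uy qy; rewrite -fg// e.
Qed.

Fact locally_rational_sub (U V : set An) (f : An -> k) : open U -> open V ->
  V `<=` U -> locally_rational U f -> locally_rational V f.
Proof.
move=> _ _ VU rf x Vx; have [p [q [qx e]]] := rf x (VU _ Vx).
by exists p, q; split=> // y Vy qy; rewrite e//; exact: VU.
Qed.

Fact locally_rational_local (U : set An) (f : An -> k) : open U ->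
  (forall x, U x -> exists V : set An,
    [/\ open V, V x, V `<=` U & locally_rational V f]) -> locally_rational U f.
Proof.
move=> _ loc x Ux; have [V [oV Vx VU rf]] := loc x Ux.
have [p [q [qx e]]] := rf x Vx; have [r [rx rV]] := oV x Vx.
exists (p * r), (q * r); rewrite poly_evalM mulf_neq0//; split=> // y Uy.
rewrite !poly_evalM mulf_eq0 negb_or => /andP[qy ry].
have Vy : V y by exact: rV.
by rewrite e// -mulf_div divff// mulr1.
Qed.

Fact locally_rational_cst (U : set An) (c : k) : open U ->
  locally_rational U (fun=> c).
Proof.
move=> _ x Ux; exists (mpoly.mpolyC n c), 1.
by rewrite poly_eval1 oner_neq0; split=> // y _ _; rewrite poly_eval1 divr1 poly_evalC.
Qed.

Fact locally_rationalD (U : set An) (f g : An -> k) : open U ->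
  locally_rational U f -> locally_rational U g ->
  locally_rational U (fun x => f x + g x).
Proof.
move=> _ rf rg x Ux.
have [p [q [qx e]]] := rf x Ux; have [p' [q' [qx' e']]] := rg x Ux.
exists (p * q' + p' * q), (q * q'); rewrite poly_evalM mulf_neq0//; split=> // y Uy.
rewrite !poly_evalM mulf_eq0 negb_or => /andP[qy qy'].
by rewrite poly_evalD !poly_evalM e// e'// addf_div.
Qed.

Fact locally_rationalM (U : set An) (f g : An -> k) : open U ->
  locally_rational U f -> locally_rational U g ->
  locally_rational U (fun x => f x * g x).
Proof.
move=> _ rf rg x Ux.
have [p [q [qx e]]] := rf x Ux; have [p' [q' [qx' e']]] := rg x Ux.
exists (p * p'), (q * q'); rewrite poly_evalM mulf_neq0//; split=> // y Uy.
rewrite !poly_evalM mulf_eq0 negb_or => /andP[qy qy'].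
by rewrite e// e'// mulf_div.
Qed.

Fact open_locally_rational_neq0 (U : set An) (f : An -> k) : open U ->
  locally_rational U f -> open [set x | U x /\ f x != 0].
Proof.
rewrite affine_space_openE => oU rf x [Ux fx]; have [p [q [qx e]]] := rf x Ux.
have [r [rx rU]] := oU x Ux.
have px : poly_eval p x != 0 by move: fx; rewrite e// mulf_eq0 negb_or => /andP[].
exists (p * q * r); rewrite !poly_evalM !mulf_neq0//; split=> // y /=.
rewrite !poly_evalM !mulf_eq0 !negb_or => /andP[/andP[py qy] ry].
have Uy : U y by exact: rU.
by split=> //; rewrite e// mulf_neq0// invr_eq0.
Qed.

Fact locally_rationalV (U : set An) (f : An -> k) : open U ->
  locally_rational U f ->
  locally_rational [set x | U x /\ f x != 0] (fun x => (f x)^-1).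
Proof.
move=> oU rf x [Ux fx]; have [p [q [qx e]]] := rf x Ux.
have px : poly_eval p x != 0 by move: fx; rewrite e// mulf_eq0 negb_or => /andP[].
exists (q * q), (p * q); rewrite poly_evalM mulf_neq0//; split=> // y [Uy _].
rewrite !poly_evalM mulf_eq0 negb_or => /andP[py qy].
by rewrite e// -mulf_div divff// mulr1 invf_div.
Qed.

HB.instance Definition _ := hasRegularFunctions.Build k An
  locally_rational_ext locally_rational_sub locally_rational_local
  locally_rational_cst locally_rationalD locally_rationalM
  open_locally_rational_neq0 locally_rationalV.

End AffineSpace.

(* A subset Z with the induced structure: its regular functions are locally the
   restrictions of regular functions of the ambient space.  The topology is the
   library's induced topology on [set_type Z]. *)
Section Subspace.
Variables (k : closedFieldType) (X : spaceWithFunctions k) (Z : set X).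

Definition locally_restriction (W : set (set_type Z)) (f : set_type Z -> k) : Prop :=
  forall z, W z -> exists (U : set X) (g : X -> k),
    [/\ open U, U (val z), regular_on U g &
        forall y, W y -> U (val y) -> f y = g (val y)].

Fact open_set_typeP (W : set (set_type Z)) :
  open W <-> forall z, W z -> exists U : set X,
    [/\ open U, U (val z) & forall y, U (val y) -> W y].
Proof.
split=> [[U oU <-] z Uz|loc]; first by exists U; rewrite -set_valE.
exists (\bigcup_(U in [set U | open U /\ forall y, U (val y) -> W y]) U).
  by apply: bigcup_open => U [].
rewrite eqEsubset; split=> z /=.
  by move=> [U [_ UW]]; rewrite set_valE; exact: UW.
by move=> /loc[U [oU Uz UW]]; exists U => //; rewrite set_valE.
Qed.

Fact locally_restriction_ext (U : set (set_type Z)) (f g : set_type Z -> k) : open U ->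
  (forall x, U x -> f x = g x) -> locally_restriction U f -> locally_restriction U g.
Proof.
move=> _ fg rf z Uz; have [V [h [oV Vz rh e]]] := rf z Uz.
by exists V, h; split=> // y Uy Vy; rewrite -fg// e.
Qed.

Fact locally_restriction_sub (U V : set (set_type Z)) (f : set_type Z -> k) :
  open U -> open V -> V `<=` U ->
  locally_restriction U f -> locally_restriction V f.
Proof.
move=> _ _ VU rf z Vz; have [W [h [oW Wz rh e]]] := rf z (VU _ Vz).
by exists W, h; split=> // y Vy Wy; apply: e => //; exact: VU.
Qed.

Fact locally_restriction_local (U : set (set_type Z)) (f : set_type Z -> k) : open U ->
  (forall x, U x -> exists V : set (set_type Z),
    [/\ open V, V x, V `<=` U & locally_restriction V f]) -> locally_restriction U f.
Proof.
move=> _ loc z Uz; have [V [/open_set_typeP oV Vz VU rf]] := loc z Uz.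
have [W [h [oW Wz rh e]]] := rf z Vz; have [W' [oW' Wz' W'V]] := oV z Vz.
exists (W `&` W'), h; split=> //; first exact: openI.
  by apply: regular_on_sub rh => //; exact: openI.
by move=> y Uy [Wy Wy']; apply: e => //; exact: W'V.
Qed.

Fact locally_restriction_cst (U : set (set_type Z)) (c : k) : open U ->
  locally_restriction U (fun=> c).
Proof.
move=> _ z _; exists setT, (fun=> c); split=> //; first exact: openT.
by apply: regular_on_cst; exact: openT.
Qed.

Fact locally_restriction_op (op : k -> k -> k) (U : set (set_type Z)) (f g : set_type Z -> k) :
  (forall (V : set X) (f' g' : X -> k), open V -> regular_on V f' ->
     regular_on V g' -> regular_on V (fun x => op (f' x) (g' x))) ->
  locally_restriction U f -> locally_restriction U g ->
  locally_restriction U (fun x => op (f x) (g x)).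
Proof.
move=> opP rf rg z Uz.
have [V [h [oV Vz rh e]]] := rf z Uz; have [V' [h' [oV' Vz' rh' e']]] := rg z Uz.
have oVV' : open (V `&` V') by exact: openI.
exists (V `&` V'), (fun x => op (h x) (h' x)); split=> //.
  apply: opP => //.
    by apply: regular_on_sub rh.
  by apply: regular_on_sub rh'.
by move=> y Uy [Vy Vy']; rewrite e// e'.
Qed.

Fact locally_restrictionD (U : set (set_type Z)) (f g : set_type Z -> k) : open U ->
  locally_restriction U f -> locally_restriction U g ->
  locally_restriction U (fun x => f x + g x).
Proof. by move=> _; apply: (@locally_restriction_op +%R) => *; exact: regular_onD. Qed.

Fact locally_restrictionM (U : set (set_type Z)) (f g : set_type Z -> k) : open U ->
  locally_restriction U f -> locally_restriction U g ->
  locally_restriction U (fun x => f x * g x).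
Proof. by move=> _; apply: (@locally_restriction_op *%R) => *; exact: regular_onM. Qed.

Fact open_locally_restriction_neq0 (U : set (set_type Z)) (f : set_type Z -> k) :
  open U -> locally_restriction U f -> open [set x | U x /\ f x != 0].
Proof.
move=> /open_set_typeP oU rf; apply/open_set_typeP => z [Uz fz].
have [V [h [oV Vz rh e]]] := rf z Uz; have [W [oW Wz WU]] := oU z Uz.
exists (W `&` [set x | V x /\ h x != 0]); split.
- by apply: openI => //; exact: open_regular_neq0.
- by split=> //; split=> //; rewrite -e.
- by move=> y [/WU Uy [Vy hy]]; split=> //; rewrite e.
Qed.

Fact locally_restrictionV (U : set (set_type Z)) (f : set_type Z -> k) : open U ->
  locally_restriction U f ->
  locally_restriction [set x | U x /\ f x != 0] (fun x => (f x)^-1).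
Proof.
move=> oU rf z [Uz fz]; have [V [h [oV Vz rh e]]] := rf z Uz.
exists [set x | V x /\ h x != 0], (fun x => (h x)^-1); split.
- exact: open_regular_neq0.
- by split=> //; rewrite -e.
- exact: regular_onV.
- by move=> y [Uy _] [Vy _]; rewrite e.
Qed.

HB.instance Definition _ := hasRegularFunctions.Build k (set_type Z)
  locally_restriction_ext locally_restriction_sub locally_restriction_local
  locally_restriction_cst locally_restrictionD locally_restrictionM
  open_locally_restriction_neq0 locally_restrictionV.

End Subspace.

(* The product in the category of spaces with functions.  Its topology is in
   general finer than the product topology: the basic open sets are the
   non-vanishing loci, on boxes U x V, of functions sum_i f_i(x) g_i(y) with f_i
   regular on U and g_i regular on V. *)
Definition zprod (k : closedFieldType) (X Y : spaceWithFunctions k) : Type :=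
  (X * Y)%type.

Section Product.
Variables (k : closedFieldType) (X Y : spaceWithFunctions k).
Local Notation XY := (zprod X Y).

Definition tensor_on (U : set X) (V : set Y) (h : XY -> k) : Prop :=
  exists (n : nat) (f : 'I_n -> X -> k) (g : 'I_n -> Y -> k),
    [/\ forall i, regular_on U (f i), forall i, regular_on V (g i) &
        forall x y, U x -> V y -> h (x, y) = \sum_(i < n) f i x * g i y].

Definition zprod_open (W : set XY) : Prop :=
  forall p, W p -> exists (U : set X) (V : set Y) (h : XY -> k),
    [/\ open U, open V, tensor_on U V h, (U `*` V) p /\ h p != 0 &
        forall q, (U `*` V) q -> h q != 0 -> W q].

Definition zprod_regular (W : set XY) (f : XY -> k) : Prop :=
  forall p, W p -> exists (U : set X) (V : set Y) (a b : XY -> k),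
    [/\ open U, open V, tensor_on U V a /\ tensor_on U V b,
        (U `*` V) p /\ b p != 0 &
        forall q, W q -> (U `*` V) q -> b q != 0 -> f q = a q / b q].

Fact tensor_on_sub (U U' : set X) (V V' : set Y) h : open U -> open V ->
  open U' -> open V' -> U' `<=` U -> V' `<=` V ->
  tensor_on U V h -> tensor_on U' V' h.
Proof.
move=> oU oV oU' oV' sU sV [n [f [g [rf rg e]]]]; exists n, f, g; split.
- by move=> i; apply: regular_on_sub (rf i).
- by move=> i; apply: regular_on_sub (rg i).
- by move=> x y U'x V'y; apply: e; [exact: sU|exact: sV].
Qed.

Fact tensor_on_subI (U U' : set X) (V V' : set Y) h : open U -> open V ->
  open U' -> open V' -> tensor_on U V h -> tensor_on (U `&` U') (V `&` V') h.
Proof.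
by move=> oU oV oU' oV'; apply: tensor_on_sub => //; try exact: openI; move=> ? [].
Qed.

Fact tensor_on_cst (U : set X) (V : set Y) (c : k) : open U -> open V ->
  tensor_on U V (fun=> c).
Proof.
move=> oU oV; exists 1%N, (fun=> fun=> c), (fun=> fun=> 1); split.
- by move=> _; exact: regular_on_cst.
- by move=> _; exact: regular_on_cst.
- by move=> x y _ _; rewrite big_ord1 mulr1.
Qed.

Fact tensor_onD (U : set X) (V : set Y) (h h' : XY -> k) :
  tensor_on U V h -> tensor_on U V h' -> tensor_on U V (fun p => h p + h' p).
Proof.
move=> [n [f [g [rf rg e]]]] [m [f' [g' [rf' rg' e']]]].
exists (n + m)%N,
  (fun i : 'I_(n + m) => match fintype.split i with inl j => f j | inr j => f' j end),
  (fun i : 'I_(n + m) => match fintype.split i with inl j => g j | inr j => g' j end); split.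
- by move=> i; case: fintype.split.
- by move=> i; case: fintype.split.
- move=> x y Ux Vy; rewrite e// e'// big_split_ord/=.
  by congr (_ + _); apply: eq_bigr => i _;
    [rewrite (unsplitK (inl i))|rewrite (unsplitK (inr i))].
Qed.

Fact tensor_onM (U : set X) (V : set Y) (h h' : XY -> k) : open U -> open V ->
  tensor_on U V h -> tensor_on U V h' -> tensor_on U V (fun p => h p * h' p).
Proof.
move=> oU oV [n [f [g [rf rg e]]]] [m [f' [g' [rf' rg' e']]]].
exists #|{: 'I_n * 'I_m}|,
  (fun i x => f (enum_val i).1 x * f' (enum_val i).2 x),
  (fun i y => g (enum_val i).1 y * g' (enum_val i).2 y); split.
- by move=> i; exact: regular_onM.
- by move=> i; exact: regular_onM.
- move=> x y Ux Vy; rewrite e// e'// big_distrlr/= pair_big/=.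
  rewrite (reindex (@enum_val _ (mem {: 'I_n * 'I_m})))/=; last first.
    by apply: onW_bij; exact: enum_val_bij.
  by apply: eq_bigr => i _; exact: mulrACA.
Qed.

Fact zprod_openT : zprod_open setT.
Proof.
move=> p _; exists setT, setT, (fun=> 1).
by split=> //; try exact: openT; [apply: tensor_on_cst; exact: openT|rewrite oner_neq0].
Qed.

Fact zprod_openI : setI_closed zprod_open.
Proof.
move=> A B oA oB p [/oA[U [V [h [oU oV th [[Up Vp] hp] hA]]]]].
move=> /oB[U' [V' [h' [oU' oV' th' [[Up' Vp'] hp'] hB]]]].
exists (U `&` U'), (V `&` V'), (fun p => h p * h' p); split.
- exact: openI.
- exact: openI.
- apply: tensor_onM; [exact: openI|exact: openI|exact: tensor_on_subI|].
  by rewrite setIC (setIC V); exact: tensor_on_subI.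
- by rewrite mulf_neq0.
- move=> q [[Uq Uq'] [Vq Vq']]; rewrite mulf_eq0 negb_or => /andP[hq hq'].
  by split; [exact: hA|exact: hB].
Qed.

Fact zprod_open_bigU (I : Type) (F : I -> set XY) :
  (forall i, zprod_open (F i)) -> zprod_open (\bigcup_i F i).
Proof.
move=> oF p [i _ /oF[U [V [h [oU oV th ph hF]]]]]; exists U, V, h; split=> //.
by move=> q UVq hq; exists i => //; exact: hF.
Qed.

HB.instance Definition _ := Choice.on XY.
HB.instance Definition _ :=
  isOpenTopological.Build XY zprod_openT zprod_openI zprod_open_bigU.

Lemma zprod_openE : @open XY = zprod_open.
Proof. by []. Qed.

Fact zprod_regular_ext (W : set XY) (f g : XY -> k) : open W ->
  (forall x, W x -> f x = g x) -> zprod_regular W f -> zprod_regular W g.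
Proof.
move=> _ fg rf p Wp; have [U [V [a [b [oU oV tab bp e]]]]] := rf p Wp.
by exists U, V, a, b; split=> // q Wq Uq bq; rewrite -fg// e.
Qed.

Fact zprod_regular_sub (W W' : set XY) (f : XY -> k) : open W -> open W' ->
  W' `<=` W -> zprod_regular W f -> zprod_regular W' f.
Proof.
move=> _ _ sW rf p Wp; have [U [V [a [b [oU oV tab bp e]]]]] := rf p (sW _ Wp).
by exists U, V, a, b; split=> // q Wq Uq bq; rewrite e//; exact: sW.
Qed.

Fact zprod_regular_local (W : set XY) (f : XY -> k) : open W ->
  (forall p, W p -> exists W' : set XY,
    [/\ open W', W' p, W' `<=` W & zprod_regular W' f]) -> zprod_regular W f.
Proof.
move=> _ loc p Wp; have [W' [oW' W'p sW rf]] := loc p Wp.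
have [U [V [a [b [oU oV [ta tb] [[Up Vp] bp] e]]]]] := rf p W'p.
have [U' [V' [h [oU' oV' th [[Up' Vp'] hp] hW]]]] := oW' p W'p.
have oUU : open (U `&` U') by exact: openI.
have oVV : open (V `&` V') by exact: openI.
have th' : tensor_on (U `&` U') (V `&` V') h.
  by rewrite setIC (setIC V); exact: tensor_on_subI.
exists (U `&` U'), (V `&` V'), (fun p => a p * h p), (fun p => b p * h p); split=> //.
- by split; apply: tensor_onM => //; exact: tensor_on_subI.
- by rewrite mulf_neq0.
- move=> q Wq [[Uq Uq'] [Vq Vq']]; rewrite mulf_eq0 negb_or => /andP[bq hq].
  have W'q : W' q by exact: hW.
  by rewrite e// -mulf_div divff// mulr1.
Qed.

Fact zprod_regular_cst (W : set XY) (c : k) : open W -> zprod_regular W (fun=> c).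
Proof.
move=> _ p _; exists setT, setT, (fun=> c), (fun=> 1); split.
- exact: openT.
- exact: openT.
- by split; apply: tensor_on_cst; exact: openT.
- by rewrite oner_neq0.
- by move=> q _ _ _; rewrite divr1.
Qed.

Fact zprod_regular2 (W : set XY) (f g : XY -> k) p : W p ->
  zprod_regular W f -> zprod_regular W g ->
  exists (U : set X) (V : set Y) (a b a' b' : XY -> k),
    [/\ open U, open V, [/\ tensor_on U V a, tensor_on U V b,
          tensor_on U V a' & tensor_on U V b'],
        [/\ (U `*` V) p, b p != 0 & b' p != 0] &
        forall q, W q -> (U `*` V) q -> b q != 0 -> b' q != 0 ->
          f q = a q / b q /\ g q = a' q / b' q].
Proof.
move=> Wp /(_ _ Wp)[U [V [a [b [oU oV [ta tb] [[Up Vp] bp] e]]]]].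
move=> /(_ _ Wp)[U' [V' [a' [b' [oU' oV' [ta' tb'] [[Up' Vp'] bp'] e']]]]].
exists (U `&` U'), (V `&` V'), a, b, a', b'; split=> //; try exact: openI.
  by split; (try exact: tensor_on_subI); rewrite setIC (setIC V); exact: tensor_on_subI.
by move=> q Wq [[Uq Uq'] [Vq Vq']] bq bq'; rewrite e// e'.
Qed.

Fact zprod_regularD (W : set XY) (f g : XY -> k) : open W ->
  zprod_regular W f -> zprod_regular W g -> zprod_regular W (fun p => f p + g p).
Proof.
move=> _ rf rg p Wp.
have [U [V [a [b [a' [b' [oU oV [ta tb ta' tb'] [UVp bp bp'] e]]]]]]] :=
  zprod_regular2 Wp rf rg.
exists U, V, (fun p => a p * b' p + a' p * b p), (fun p => b p * b' p); split=> //.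
- split; last exact: tensor_onM.
  by apply: tensor_onD; exact: tensor_onM.
- by rewrite mulf_neq0.
- move=> q Wq UVq; rewrite mulf_eq0 negb_or => /andP[bq bq'].
  by have [-> ->] := e q Wq UVq bq bq'; rewrite addf_div.
Qed.

Fact zprod_regularM (W : set XY) (f g : XY -> k) : open W ->
  zprod_regular W f -> zprod_regular W g -> zprod_regular W (fun p => f p * g p).
Proof.
move=> _ rf rg p Wp.
have [U [V [a [b [a' [b' [oU oV [ta tb ta' tb'] [UVp bp bp'] e]]]]]]] :=
  zprod_regular2 Wp rf rg.
exists U, V, (fun p => a p * a' p), (fun p => b p * b' p); split=> //.
- by split; exact: tensor_onM.
- by rewrite mulf_neq0.
- move=> q Wq UVq; rewrite mulf_eq0 negb_or => /andP[bq bq'].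
  by have [-> ->] := e q Wq UVq bq bq'; rewrite mulf_div.
Qed.

Fact open_zprod_regular_neq0 (W : set XY) (f : XY -> k) : open W ->
  zprod_regular W f -> open [set p | W p /\ f p != 0].
Proof.
rewrite zprod_openE => oW rf p [Wp fp].
have [U [V [a [b [oU oV [ta tb] [[Up Vp] bp] e]]]]] := rf p Wp.
have [U' [V' [h [oU' oV' th [[Up' Vp'] hp] hW]]]] := oW p Wp.
have ap : a p != 0 by move: fp; rewrite e// mulf_eq0 negb_or => /andP[].
have oUU : open (U `&` U') by exact: openI.
have oVV : open (V `&` V') by exact: openI.
have th' : tensor_on (U `&` U') (V `&` V') h.
  by rewrite setIC (setIC V); exact: tensor_on_subI.
exists (U `&` U'), (V `&` V'), (fun p => a p * b p * h p); split=> //.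
- by apply: tensor_onM => //; apply: tensor_onM => //; exact: tensor_on_subI.
- by rewrite !mulf_neq0.
- move=> q [[Uq Uq'] [Vq Vq']]; rewrite !mulf_eq0 !negb_or.
  move=> /andP[/andP[aq bq] hq].
  have Wq : W q by exact: hW.
  by split=> //; rewrite e// mulf_neq0// invr_eq0.
Qed.

Fact zprod_regularV (W : set XY) (f : XY -> k) : open W -> zprod_regular W f ->
  zprod_regular [set p | W p /\ f p != 0] (fun p => (f p)^-1).
Proof.
move=> oW rf p [Wp fp].
have [U [V [a [b [oU oV [ta tb] [[Up Vp] bp] e]]]]] := rf p Wp.
have ap : a p != 0 by move: fp; rewrite e// mulf_eq0 negb_or => /andP[].
exists U, V, (fun p => b p * b p), (fun p => a p * b p); split=> //.
- by split; exact: tensor_onM.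
- by rewrite mulf_neq0.
- move=> q [Wq _] UVq; rewrite mulf_eq0 negb_or => /andP[aq bq].
  by rewrite e// -mulf_div divff// mulr1 invf_div.
Qed.

HB.instance Definition _ := hasRegularFunctions.Build k XY
  zprod_regular_ext zprod_regular_sub zprod_regular_local
  zprod_regular_cst zprod_regularD zprod_regularM
  open_zprod_regular_neq0 zprod_regularV.

End Product.

Definition affine_variety (k : closedFieldType) (X : spaceWithFunctions k) : Prop :=
  exists (n : nat) (Z : set (affine_space k n)),
    closed Z /\ isomorphic X (set_type Z).

Definition separated_space (k : closedFieldType) (X : spaceWithFunctions k) : Prop :=
  closed [set p : zprod X X | p.1 = p.2].

(* Varieties are allowed to be reducible here; irreducibility is imposed
   separately where it is needed. *)
Definition variety (k : closedFieldType) (X : spaceWithFunctions k) : Prop :=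
  (exists (m : nat) (U : 'I_m -> set X),
    (forall i, open (U i) /\ affine_variety (set_type (U i))) /\
    \bigcup_(i in [set: 'I_m]) U i = setT) /\
  separated_space X.

Definition complete_variety (k : closedFieldType) (X : spaceWithFunctions k) : Prop :=
  forall Y : spaceWithFunctions k, variety Y ->
  forall Z : set (zprod X Y), closed Z -> closed [set p.2 | p in Z].

Definition irreducible_space (T : topologicalType) : Prop :=
  (exists x : T, True) /\
  forall F G : set T, closed F -> closed G -> F `|` G = setT ->
    F = setT \/ G = setT.

(* An abelian variety is a complete irreducible group variety.  The group law is
   written multiplicatively; its commutativity is a theorem, not an axiom. *)
HB.mixin Record isAbelianVariety (k : closedFieldType) (A : Type)
    & SpaceWithFunctions k A & Group A := {
  abelian_variety_variety : variety A;
  abelian_variety_irreducible : irreducible_space A;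
  abelian_variety_complete : complete_variety A;
  mulg_regular : regular_map (fun p : zprod A A => (p.1 * p.2)%g);
  invg_regular : regular_map (fun x : A => (x^-1)%g)
}.

#[short(type="abelianVariety")]
HB.structure Definition AbelianVariety (k : closedFieldType) :=
  {A of SpaceWithFunctions k A & Group A & isAbelianVariety k A}.

(* An irreducible closed subset that is a subgroup, i.e. a closed subvariety which
   is a group variety for the induced law; as a closed subset of A it is
   automatically complete. *)
Definition abelian_subvariety (k : closedFieldType) (A : abelianVariety k)
    (B : set A) : Prop :=
  [/\ closed B, irreducible_space (set_type B), B 1%g,
      forall x y, B x -> B y -> B (x * y)%g & forall x, B x -> B (x^-1)%g].

Definition simple_abelian (k : closedFieldType) (A : abelianVariety k) : Prop :=
  (exists x : A, x <> 1%g) /\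
  forall B : set A, abelian_subvariety B -> B = [set 1%g] \/ B = setT.

(* A k-linear derivation of the structure sheaf.  [der U f] is the image of the
   section f over the open set U; as for [regular_on], only its values on U
   matter, and [der_restrict] (with V = U) says in particular that they depend
   only on the section. *)
Record vector_field (k : closedFieldType) (X : spaceWithFunctions k) := VectorField {
  der :> set X -> (X -> k) -> X -> k;
  der_regular : forall (U : set X) (f : X -> k), open U ->
    regular_on U f -> regular_on U (der U f);
  der_restrict : forall (U V : set X) (f g : X -> k), open U -> open V ->
    V `<=` U -> regular_on U f -> regular_on V g ->
    (forall x, V x -> f x = g x) -> forall x, V x -> der U f x = der V g x;
  der_linear : forall (U : set X) (c : k) (f g : X -> k), open U ->
    regular_on U f -> regular_on U g ->
    forall x, U x -> der U (fun y => c * f y + g y) x = c * der U f x + der U g x;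
  der_leibniz : forall (U : set X) (f g : X -> k), open U ->
    regular_on U f -> regular_on U g ->
    forall x, U x -> der U (fun y => f y * g y) x = der U f x * g x + f x * der U g x
}.

Definition nontrivial_field (k : closedFieldType) (X : spaceWithFunctions k)
    (v : vector_field X) : Prop :=
  exists (U : set X) (f : X -> k) (x : X),
    [/\ open U, regular_on U f, U x & v U f x != 0].

(* v preserves the ideal sheaf of Y with its reduced structure: over U this is the
   ideal of the regular functions vanishing on the points of Y in U. *)
Definition invariant_set (k : closedFieldType) (X : spaceWithFunctions k)
    (v : vector_field X) (Y : set X) : Prop :=
  forall (U : set X) (f : X -> k), open U -> regular_on U f ->
    (forall x, U x -> Y x -> f x = 0) ->
    forall x, U x -> Y x -> v U f x = 0.

Definition wild (k : closedFieldType) (X : spaceWithFunctions k)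
    (v : vector_field X) : Prop :=
  ~ exists Y : set X, [/\ closed Y, Y !=set0, Y != setT & invariant_set v Y].

(* Main.v *)
(* Every vector field v on A is translation invariant: for f regular near 1, the
   derivative at x of [y |-> f (x^-1 * y)] is a regular function of x on all of A, hence
   constant.  The same argument applied to the pull-back of v along the inverse map shows
   that the inverse map sends v to -v.  Let Z be the closure of the formal orbit of 1, i.e.
   the zero set of the functions f all of whose iterated derivatives v^n f vanish at 1; in
   characteristic zero these form a prime ideal, so Z is irreducible.  By invariance xZ is
   the orbit closure of x, so Z is closed under products, and under inverses because v is
   mapped to -v.  Thus Z is an abelian subvariety; it is not {1} because v is nonzero at 1, so
   Z = A by simplicity.  By translation every orbit is dense, whereas an invariant
   closed set contains the orbit closures of its points. *)
Require Import Defs.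
From HB Require Import structures.
From mathcomp Require Import all_boot all_order all_algebra.
From mathcomp Require Import all_classical all_reals topology.
From mathcomp Require Import ring.
From mathcomp Require mpoly.
Import (canonicals) mpoly.

Set Implicit Arguments.
Unset Strict Implicit.
Unset Printing Implicit Defensive.

Import GRing.Theory.
Local Open Scope classical_set_scope.
Local Open Scope ring_scope.

(** * The Nullstellensatz *)

(** Only closed points exist here, while the argument concerns the generic point of the formal
    orbit, which is not closed once [v] is nontrivial. That point is replaced by the filter
    [orbit_meets] of the sets containing it in their interior; the Nullstellensatz leads back from
    this filter to closed points. The delicate step is closure under products: it also requires that
    the orbit closure of a point x of Z lies in Z. For a function f defined around both 1 and x this
    is immediate: if f is flat at 1, all its derivatives are flat at 1, hence vanish on Z, in
    particular at x. But a function given near x need not be defined at 1. It is therefore written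
    as a fraction of coordinate polynomials around 1, and the two sides are compared at a third
    point z of Z that lies in the chart of 1. *)

Definition prime_ideal (R : comNzRingType) (P : set R) : Prop :=
  [/\ P 0, forall f g, P f -> P g -> P (f + g), forall f g, P g -> P (f * g),
      ~ P 1 & forall f g, P (f * g) -> P f \/ P g].

Lemma prime_idealB (R : comNzRingType) (P : set R) f g :
  prime_ideal P -> P f -> P g -> P (f - g).
Proof. by move=> [_ PD PM _ _] Pf Pg; rewrite -mulN1r; apply: PD => //; apply: PM. Qed.

Lemma prime_ideal_preim (R S : comNzRingType) (h : {rmorphism R -> S}) (P : set S) :
  prime_ideal P -> prime_ideal (h @^-1` P).
Proof.
move=> [P0 PD PM P1 PP]; split => /=.
- by rewrite /preimage/= rmorph0.
- by move=> f g; rewrite /preimage/= rmorphD; exact: PD.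
- by move=> f g; rewrite /preimage/= rmorphM; exact: PM.
- by rewrite /preimage/= rmorph1.
- by move=> f g; rewrite /preimage/= rmorphM; exact: PP.
Qed.

(** * Extending homomorphisms to an algebraically closed field from [R] to [R[X]], modulo a prime
    ideal *)

Section Extension.
Variables (R : comNzRingType) (P : set {poly R}).
Hypothesis primeP : prime_ideal P.

(* Membership in the extension to R[X] of the contraction of P to R. *)
Definition coefs_in (q : {poly R}) := forall i, P (q`_i)%:P.

Lemma coefs_in_mem q : coefs_in q -> P q.
Proof.
case: primeP => P0 PD PM _ _ cq; rewrite -(coefK q) poly_def.
elim/big_ind: _ => // i _; by rewrite -mul_polyC mulrC; apply: PM.
Qed.

Lemma coefs_inD (f g : {poly R}) : coefs_in f -> coefs_in g -> coefs_in (f + g).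
Proof. by case: primeP => _ PD _ _ _ cf cg i; rewrite coefD polyCD; apply: PD. Qed.

Lemma coefs_inM (f g : {poly R}) : coefs_in g -> coefs_in (f * g).
Proof.
case: primeP => P0 PD PM _ _ cg i; rewrite coefM rmorph_sum/=.
by elim/big_ind: _ => // j _; rewrite polyCM; apply: PM.
Qed.

(** This normalization replaces passing to polynomials over the domain [R] modulo the contraction of
    [P]: dropping leading terms with coefficient in the contraction makes [size] the size over that
    domain. *)
Lemma trim_coefs (b : {poly R}) : exists b' : {poly R},
  [/\ (size b' <= size b)%N, coefs_in (b - b') & b' = 0 \/ ~ P (lead_coef b')%:P].
Proof.
have [n] := ubnP (size b); elim: n b => // n IH b sb.
have [P0 PD PM _ _] := primeP.
have c0 : coefs_in 0 by move=> i; rewrite coef0.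
have [Pl|nPl] := pselect (P (lead_coef b)%:P); last first.
  by exists b; split=> //; [rewrite subrr|right].
have [->|b0] := eqVneq b 0; first by exists 0; split; [|rewrite subrr|left].
pose t := lead_coef b *: 'X^((size b).-1).
have ct : coefs_in t by move=> i; rewrite /t coefZ coefXn mulrC polyCM; exact: PM.
have sE : size b = (size b).-1.+1 by rewrite prednK// size_poly_gt0.
have sbt : (size (b - t)%R < size b)%N.
  rewrite sE ltnS; apply/leq_sizeP => j.
  rewrite coefB /t coefZ coefXn leq_eqVlt => /orP[/eqP<-|lj].
    by rewrite eqxx mulr1 lead_coefE subrr.
  by rewrite gtn_eqF// mulr0 subr0 nth_default// sE.
have [|b' [sb' cb' lb']] := IH (b - t); first exact: leq_trans sbt _.
exists b'; split=> //; first exact: leq_trans sb' (ltnW sbt).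
by rewrite -(subrK t b) addrAC; exact: coefs_inD.
Qed.

Lemma trim_mem (b b' : {poly R}) : coefs_in (b - b') -> P b <-> P b'.
Proof.
have [_ PD PM _ _] := primeP.
move=> /coefs_in_mem Pbb; split=> Pb.
  by rewrite -(subKr b b'); apply: prime_idealB.
by rewrite -(subrK b' b); apply: PD.
Qed.

(** * The minimal polynomial of [X] over the fraction field of [R] modulo the contraction of [P] *)

Section Minimal.
Variable p : {poly R}.
Hypotheses (Pp : P p) (lp : ~ P (lead_coef p)%:P).
Hypothesis minp : forall q, P q -> ~ P (lead_coef q)%:P -> (size p <= size q)%N.

Lemma size_min_gt1 : (1 < size p)%N.
Proof.
rewrite ltnNge; apply: contra_notN lp => /size1_polyC e.
by move: (Pp); rewrite {1}e {2}e lead_coefC.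
Qed.

Lemma coefs_in_small q : P q -> (size q < size p)%N -> coefs_in q.
Proof.
move=> Pq sq; have [q' [sq' cq' [q0|nl]]] := trim_coefs q.
  by move: cq'; rewrite q0 subr0.
have := minp (proj1 (trim_mem cq') Pq) nl.
by move=> /leq_trans/(_ sq')/leq_ltn_trans/(_ sq); rewrite ltnn.
Qed.

Lemma nonmem_exp c m : ~ P c -> ~ P (c ^+ m).
Proof.
case: primeP => _ _ _ P1 PP nc; elim: m => [|m IH]; first by rewrite expr0.
by rewrite exprS => /PP[].
Qed.

(* A fraction-free Euclidean algorithm: dividing the polynomial p of least degree by b
   leaves remainders of decreasing size outside P, until one is constant. *)
Lemma const_multiple_small (b : {poly R}) : ~ P b -> (size b < size p)%N ->
  exists (w : {poly R}) (r : R), ~ P r%:P /\ P (w * b - r%:P).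
Proof.
have [P0 PD PM P1 PP] := primeP.
have [n] := ubnP (size b); elim: n b => // n IH b0 sb0 nPb0 sb0p.
have [b [sb cb lb]] := trim_coefs b0.
have nPb : ~ P b by move=> /(trim_mem cb).
suff [w [r [nr wr]]] : exists (w : {poly R}) (r : R), ~ P r%:P /\ P (w * b - r%:P).
  exists w, r; split=> //.
  have -> : w * b0 - r%:P = (w * b - r%:P) + w * (b0 - b) by ring.
  by apply: PD => //; apply: PM; exact: coefs_in_mem.
have {}lb : ~ P (lead_coef b)%:P by case: lb => // b00; rewrite b00 in nPb.
have [s1|s1] := leqP (size b) 1.
  exists 1, (b`_0); rewrite -size1_polyC// mul1r subrr; split=> //.
have b_neq0 : b != 0 by rewrite -size_poly_gt0 (ltn_trans _ s1).
have := Pdiv.ComRing.rdivp_eq b p.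
set m := Pdiv.CommonRing.rscalp p b; set s := Pdiv.CommonRing.rdivp p b.
set rem := Pdiv.CommonRing.rmodp p b => e.
have srem : (size rem < size b)%N by rewrite Pdiv.CommonRing.ltn_rmodp.
have Pe : P (s * b + rem) by rewrite -e -mul_polyC; apply: PM.
have [Prem|nPrem] := pselect (P rem); last first.
  have [|//||w [r [nr wr]]] := IH rem.
  - by rewrite (leq_trans srem)// (leq_trans sb).
  - rewrite (leq_ltn_trans _ sb0p)// (leq_trans (ltnW srem))//.
  exists (- (w * s)), r; split=> //.
  have -> : - (w * s) * b - r%:P = (w * rem - r%:P) - w * (s * b + rem) by ring.
  by apply: prime_idealB => //; apply: PM.
(* If the remainder were in [P], then so would be [s], because [b] is not. By minimality the trimmed
   quotient [s'] is zero or at least as long as [p]. As [b] is not constant, in the second case the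
   leading term of [s' * b] lies beyond the degree of [p], although both sides agree up to
   coefficients in the contraction. *)
exfalso.
have crem : coefs_in rem.
  apply: coefs_in_small => //; rewrite (leq_ltn_trans _ sb0p)// (leq_trans (ltnW srem))//.
have Ps : P s.
  have : P (s * b) by rewrite -(addrK rem (s * b)); apply: prime_idealB.
  by move=> /PP[].
have [s' [_ cs ls]] := trim_coefs s.
have Ps' : P s' by apply/(trim_mem cs).
have cdiff : coefs_in (lead_coef b ^+ m *: p - s' * b).
  have -> : lead_coef b ^+ m *: p - s' * b = rem + b * (s - s') by rewrite e; ring.
  by apply: coefs_inD => //; apply: coefs_inM.
case: ls => [s0|ls].
  move: cdiff => /(_ (size p).-1); rewrite s0 mul0r subr0 coefZ -lead_coefE polyCM.
  by rewrite rmorphXn/= => /PP[]//; exact: nonmem_exp.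
have sps := minp Ps' ls.
have := cdiff (size s' + size b).-2.
rewrite coefB coefZ -mul_lead_coef nth_default ?mulr0 ?sub0r; last first.
  by rewrite -subn2 -addnBA// (leq_trans sps)// leq_addr.
rewrite -mulN1r polyCM => /PP[|].
  by move=> /(PM (-1)%:P); rewrite -polyCM mulrNN mul1r.
by rewrite polyCM => /PP[].
Qed.

Lemma reduce_min (b : {poly R}) : exists (m : nat) (s rem : {poly R}),
  lead_coef p ^+ m *: b = s * p + rem /\ (size rem < size p)%N.
Proof.
exists (Pdiv.CommonRing.rscalp b p), (Pdiv.CommonRing.rdivp b p).
exists (Pdiv.CommonRing.rmodp b p); rewrite Pdiv.ComRing.rdivp_eq; split=> //.
by rewrite Pdiv.CommonRing.ltn_rmodp -size_poly_gt0 (ltn_trans _ size_min_gt1).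
Qed.

(** The polynomial [p] makes [R[X]/P] algebraic over the image of [R], and in a domain algebraic
    over a subring every nonzero element divides a nonzero element of the subring. Pseudo-division
    by [p] reduces to small size. *)
Lemma const_multiple (b : {poly R}) : ~ P b ->
  exists (w : {poly R}) (r : R), ~ P r%:P /\ P (w * b - r%:P).
Proof.
have [P0 PD PM P1 PP] := primeP.
move=> nPb; have [m [s [rem [e srem]]]] := reduce_min b.
have nPrem : ~ P rem.
  move=> Prem; have : P (lead_coef p ^+ m *: b).
    by rewrite e; apply: PD => //; apply: PM.
  by rewrite -mul_polyC rmorphXn => /PP[]//; exact: nonmem_exp.
have [w [r [nr wr]]] := const_multiple_small nPrem srem.
exists (w * (lead_coef p ^+ m)%:P), r; split=> //.
rewrite -mulrA mul_polyC e.
have -> : w * (s * p + rem) - r%:P = (w * rem - r%:P) + w * s * p by ring.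
by apply: PD => //; apply: PM.
Qed.

End Minimal.

Lemma map_coefs_in (k : nzRingType) (phi : {rmorphism R -> k}) q :
  (forall r, P r%:P -> phi r = 0) -> coefs_in q -> map_poly phi q = 0.
Proof. by move=> h cq; apply/polyP => i; rewrite coef_map coef0 /= h. Qed.

Lemma extend_hom (k : closedFieldType) b : ~ P b -> exists a : R, ~ P a%:P /\
  forall phi : {rmorphism R -> k}, (forall r, P r%:P -> phi r = 0) -> phi a != 0 ->
  exists xi : k, (forall q, P q -> (map_poly phi q).[xi] = 0) /\
     (map_poly phi b).[xi] != 0.
Proof.
move=> nPb; have [P0 PD PM P1 PP] := primeP.
have [exq|nexq] :=
  pselect (exists s, exists q : {poly R}, size q = s /\ P q /\ ~ P (lead_coef q)%:P).
  have exq' : exists s, `[< exists q : {poly R}, size q = s /\ P q /\ ~ P (lead_coef q)%:P >].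
    by case: exq => s hs; exists s; apply/asboolP.
  case: (ex_minnP exq') => s /asboolP[p [<-{s} [Pp lp]]] min.
  have minp (q : {poly R}) : P q -> ~ P (lead_coef q)%:P -> (size p <= size q)%N.
    by move=> Pq lq; apply: min; apply/asboolP; exists q.
  have [w [r [nr wr]]] := const_multiple Pp lp minp nPb.
  (* The factor [lead_coef p] preserves the degree of [p] under [phi], so a root exists and
     pseudo-division by [p] can be cancelled at it. The factor [r] keeps the value of [b] nonzero,
     since [w * b] equals [r] modulo [P]. *)
  exists (r * lead_coef p); split; first by rewrite polyCM => /PP[].
  move=> phi phi0; rewrite rmorphM mulf_eq0 negb_or => /andP[pr pl].
  have : size (map_poly phi p) != 1%N.
    by rewrite size_map_poly_id0// gtn_eqF// size_min_gt1.
  move=> /closed_rootP[xi /rootP xiP]; exists xi.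
  have van q : P q -> (map_poly phi q).[xi] = 0.
    move=> Pq; have [m [s [rem [e srem]]]] := reduce_min Pp lp q.
    have Prem : P rem.
      have -> : rem = (lead_coef p ^+ m)%:P * q - s * p by rewrite mul_polyC e; ring.
      by apply: prime_idealB => //; apply: PM.
    have := congr1 (fun q => (map_poly phi q).[xi]) e.
    rewrite /= map_polyZ rmorphD rmorphM/= (map_coefs_in phi0 (q := rem)); last first.
      exact: (coefs_in_small minp).
    rewrite hornerZ hornerD hornerM xiP mulr0 horner0 addr0 rmorphXn => /eqP.
    by rewrite mulf_eq0 expf_eq0 (negPf pl) andbF => /eqP.
  split=> //; have := van _ wr.
  rewrite rmorphB rmorphM/= map_polyC/= hornerD hornerM hornerN hornerC => /eqP.
  by rewrite subr_eq0 => /eqP e; apply: contraNneq pr => b0; rewrite -e b0 mulr0.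
(* The transcendental case: [P] is extended from its contraction, so every [xi] is a zero of it, and
   only the roots of the image of [b] must be avoided. *)
have coefs_inT q : P q -> coefs_in q.
  move=> Pq; have [q' [_ cq [q0|lq']]] := trim_coefs q.
    by move: cq; rewrite q0 subr0.
  by exfalso; apply: nexq; exists (size q'), q'; split=> //; split=> //; apply/(trim_mem cq).
have [i nbi] : exists i, ~ P (b`_i)%:P.
  by apply/existsNP => cb; apply: nPb; exact: coefs_in_mem.
exists b`_i; split=> // phi phi0 pa.
have : map_poly phi b != 0 by apply: contraNneq pa => e; rewrite -coef_map e coef0.
move=> /closed_nonrootP[xi xiP]; exists xi; split=> // q /coefs_inT cq.
by rewrite map_coefs_in// horner0.
Qed.
End Extension.

Section Nullstellensatz.
Variable k : closedFieldType.
Local Notation mpoly n := (mpoly.mpoly n k).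

Definition mpoly_var n (i : 'I_n) : mpoly n := mpoly.mpolyX k (mpoly.mnm1 i).

Lemma mpoly_alg_ind n (Q : mpoly n -> Prop) :
  (forall c, Q (mpoly.mpolyC n c)) -> (forall i, Q (mpoly_var i)) ->
  (forall p q, Q p -> Q q -> Q (p + q)) -> (forall p q, Q p -> Q q -> Q (p * q)) ->
  forall p, Q p.
Proof.
move=> QC QX QD QM; apply: mpoly.mpolyind.
  by rewrite -mpoly.mpolyC0; exact: QC.
move=> c m p _ _ Qp; apply: (QD _ _) => //; rewrite -mpoly.mul_mpolyC; apply: (QM _ _) => //.
rewrite mpoly.mpolyXE_id; elim/big_ind: _ => [|p1 p2|i _]; last 1 first.
- elim: (mpoly.fun_of_multinom m i) => [|e IH]; first by rewrite expr0 -mpoly.mpolyC1.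
  by rewrite exprS; apply: (QM _ _) => //; exact: QX.
- by rewrite -mpoly.mpolyC1; exact: QC.
- exact: (QM _ _).
Qed.

Definition mpoly_of_poly n (q : {poly mpoly n}) : mpoly n.+1 :=
  (map_poly (@mpoly.mwiden n k) q).[mpoly_var ord_max].

Fact mpoly_of_poly_is_additive n : zmod_morphism (@mpoly_of_poly n).
Proof. by move=> p q; rewrite /mpoly_of_poly rmorphB hornerD hornerN. Qed.

Fact mpoly_of_poly_is_multiplicative n : monoid_morphism (@mpoly_of_poly n).
Proof.
split; first by rewrite /mpoly_of_poly rmorph1 hornerC.
by move=> p q; rewrite /mpoly_of_poly rmorphM hornerM.
Qed.

HB.instance Definition _ n := GRing.isZmodMorphism.Build {poly mpoly n} (mpoly n.+1)
  (@mpoly_of_poly n) (@mpoly_of_poly_is_additive n).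
HB.instance Definition _ n := GRing.isMonoidMorphism.Build {poly mpoly n} (mpoly n.+1)
  (@mpoly_of_poly n) (@mpoly_of_poly_is_multiplicative n).

Lemma mpoly_of_poly_surj n (p : mpoly n.+1) : exists q, mpoly_of_poly q = p.
Proof.
elim/mpoly_alg_ind: p.
- move=> c; exists (mpoly.mpolyC n c)%:P.
  by rewrite /mpoly_of_poly map_polyC hornerC /= mpoly.mwidenC.
- move=> i; have [i' ->|->] := unliftP ord_max i; last first.
    by exists 'X; rewrite /mpoly_of_poly map_polyX hornerX.
  exists (mpoly_var i')%:P.
  rewrite /mpoly_of_poly map_polyC hornerC /= mpoly.mwidenX mpoly.mnmwiden1.
  by congr (mpoly.mpolyX k (mpoly.mnm1 _)); apply/val_inj; rewrite /= /bump leqNgt ltn_ord.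
- by move=> _ _ [p <-] [q <-]; exists (p + q); rewrite rmorphD.
- by move=> _ _ [p <-] [q <-]; exists (p * q); rewrite rmorphM.
Qed.

Lemma meval_of_poly n (z : 'I_n -> k) xi q (y : 'I_n.+1 -> k) :
  (forall i, y (widen_ord (leqnSn n) i) = z i) -> y ord_max = xi ->
  mpoly.meval y (mpoly_of_poly q) = (map_poly (mpoly.meval z) q).[xi].
Proof.
move=> yz yxi.
have wid p : mpoly.meval y (mpoly.mwiden p) = mpoly.meval z p.
  elim/mpoly_alg_ind: p.
  - by move=> c; rewrite mpoly.mwidenC !mpoly.mevalC.
  - by move=> i; rewrite mpoly.mwidenX mpoly.mnmwiden1 !mpoly.mevalXU yz.
  - by move=> p p' e e'; rewrite mpoly.mwidenD !mpoly.mevalD e e'.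
  - by move=> p p' e e'; rewrite mpoly.mwidenM !mpoly.mevalM e e'.
rewrite /mpoly_of_poly -horner_map/= mpoly.mevalXU yxi -map_poly_comp.
by congr (_.[_]); apply: eq_map_poly => p /=; rewrite wid.
Qed.

(** Avoiding the zeros of [b] is built in so that the induction runs: the element [a] of
    [extend_hom] takes over the role of [b] for the contraction of [P] to one variable less, and a
    zero of that contraction at which [a] is nonzero lifts. *)
Lemma nullstellensatz n (P : set (mpoly n)) b : prime_ideal P -> ~ P b ->
  exists z : 'I_n -> k, (forall q, P q -> mpoly.meval z q = 0) /\ mpoly.meval z b != 0.
Proof.
elim: n P b => [|n IH] P b primeP nPb; have [P0 PD PM P1 PP] := primeP.
  have cst (p : mpoly 0) : p = mpoly.mpolyC 0 (mpoly.meval (fun=> 0) p).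
    elim/mpoly_alg_ind: p => [c|[]//|p q e e'|p q e e'].
    - by rewrite mpoly.mevalC.
    - by rewrite mpoly.mevalD mpoly.mpolyCD -e -e'.
    - by rewrite mpoly.mevalM mpoly.mpolyCM -e -e'.
  exists (fun=> 0); split.
    move=> q Pq; apply/eqP/negPn/negP => q0; apply: P1.
    rewrite -(mpoly.mpolyC1 0) -(mulVf q0) mpoly.mpolyCM -cst; exact: PM.
  by apply: contra_notN nPb => /eqP b0; rewrite (cst b) b0 mpoly.mpolyC0.
have [b' bE] := mpoly_of_poly_surj b.
pose P' := @mpoly_of_poly n @^-1` P.
have primeP' : prime_ideal P' by exact: prime_ideal_preim.
have nPb' : ~ P' b' by rewrite /P' /preimage/= bE.
have [a [na aP]] := extend_hom primeP' k nPb'.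
have [z [zP za]] := IH _ _ (prime_ideal_preim (@polyC (mpoly n)) primeP') na.
have [xi [xiP xib]] := aP (mpoly.meval z) zP za.
pose y (i : 'I_n.+1) := if unlift ord_max i is Some j then z j else xi.
have yz i : y (widen_ord (leqnSn n) i) = z i.
  have -> : widen_ord (leqnSn n) i = lift ord_max i.
    by apply/val_inj; rewrite /= /bump leqNgt ltn_ord.
  by rewrite /y liftK.
have yxi : y ord_max = xi by rewrite /y unlift_none.
exists y; split; last by rewrite -bE (meval_of_poly _ yz yxi).
move=> q; have [q' <-] := mpoly_of_poly_surj q => Pq'.
by rewrite (meval_of_poly _ yz yxi); exact: xiP.
Qed.

End Nullstellensatz.

(** * Regular functions and affine charts *)

Section RegularFunctions.
Variables (k : closedFieldType) (X : spaceWithFunctions k).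

Lemma eq_regular_on (U : set X) (g f : X -> k) : open U -> regular_on U g ->
  (forall x, U x -> f x = g x) -> regular_on U f.
Proof. by move=> oU rg fg; apply: regular_on_ext rg => // x Ux; rewrite fg. Qed.

Lemma regular_on_locally (U : set X) (f : X -> k) : open U ->
  (forall x, U x -> exists V g, [/\ open V, V x, regular_on V g &
    forall y, U y -> V y -> f y = g y]) -> regular_on U f.
Proof.
move=> oU loc; apply: regular_on_local => // x Ux.
have [V [g [oV Vx rg fg]]] := loc x Ux.
have oUV : open (U `&` V) by exact: openI.
exists (U `&` V); split=> //.
apply: (@eq_regular_on _ g) => //; last by move=> y [Uy Vy]; rewrite fg.
by apply: regular_on_sub rg.
Qed.

Lemma regular_on_sum (U : set X) n (f : 'I_n -> X -> k) : open U ->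
  (forall i, regular_on U (f i)) -> regular_on U (fun x => \sum_(i < n) f i x).
Proof.
move=> oU; elim: n f => [|n IH] f rf.
  by apply: (eq_regular_on oU (regular_on_cst U 0 oU)) => x _; rewrite big_ord0.
apply: (@eq_regular_on _ (fun x =>
  \sum_(i < n) f (widen_ord (leqnSn n) i) x + f ord_max x)) => //; last first.
  by move=> x _; rewrite big_ord_recr.
by apply: regular_onD => //; apply: IH.
Qed.

Lemma regular_onB (U : set X) (f g : X -> k) : open U ->
  regular_on U f -> regular_on U g -> regular_on U (fun x => f x - g x).
Proof.
move=> oU rf rg.
apply: (@eq_regular_on _ (fun x => f x + (fun=> -1) x * g x)) => //; last first.
  by move=> x _; rewrite /= mulN1r.
by apply: regular_onD => //; apply: regular_onM => //; exact: regular_on_cst.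
Qed.

Lemma irreducible_meet (U V : set X) : irreducible_space X -> open U -> open V ->
  U !=set0 -> V !=set0 -> U `&` V !=set0.
Proof.
move=> [_ irr] oU oV [x Ux] [y Vy]; apply: contrapT => UV0.
have [] := irr (~` U) (~` V).
- exact: open_closedC.
- exact: open_closedC.
- rewrite -setCI; apply/seteqP; split=> // z _ UVz; by apply: UV0; exists z.
- by move=> /seteqP[_ /(_ x I)]; exact.
- by move=> /seteqP[_ /(_ y I)]; exact.
Qed.

(** The identity principle: a nonempty nonvanishing locus of [f] would be open and meet the open set
    on which [f] is zero. *)
Lemma regular_on_dense (U V : set X) (f : X -> k) : irreducible_space X ->
  open U -> open V -> regular_on U f -> U `&` V !=set0 ->
  (forall x, U x -> V x -> f x = 0) -> forall x, U x -> f x = 0.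
Proof.
move=> irr oU oV rf [z [Uz Vz]] f0 x Ux; apply/eqP/negPn/negP => fx.
have [||||y [[Uy fy] [_ Vy]]] :=
  irreducible_meet (U := [set x | U x /\ f x != 0]) (V := U `&` V) irr.
- exact: open_regular_neq0.
- exact: openI.
- by exists x.
- by exists z.
- by move: fy; rewrite f0// eqxx.
Qed.

End RegularFunctions.

Section Charts.
Variables (k : closedFieldType) (X : spaceWithFunctions k).

(* [c] gives the coordinates of an isomorphism of [U0] onto a closed subset of
   affine n-space; its values outside [U0] are junk. *)
Record affine_chart (U0 : set X) n (c : X -> 'I_n -> k) : Prop := AffineChart {
  chart_open : open U0;
  chart_regular : forall q, regular_on U0 (fun x => mpoly.meval (c x) q);
  chart_basis : forall (W : set X) z, open W -> W z -> U0 z -> exists q,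
    mpoly.meval (c z) q != 0 /\ forall y, U0 y -> mpoly.meval (c y) q != 0 -> W y;
  chart_fraction : forall (U : set X) f z, open U -> regular_on U f -> U z -> U0 z ->
    exists a b, mpoly.meval (c z) b != 0 /\ forall y, U y -> U0 y ->
      mpoly.meval (c y) b != 0 -> f y * mpoly.meval (c y) b = mpoly.meval (c y) a;
  chart_closed : forall w, (forall q, (forall y, U0 y -> mpoly.meval (c y) q = 0) ->
      mpoly.meval w q = 0) -> exists z, U0 z /\ c z = w }.

Lemma affine_variety_chart (U0 : set X) : open U0 -> affine_variety (set_type U0) ->
  exists n (c : X -> 'I_n -> k), affine_chart U0 c.
Proof.
move=> oU0 [n [Z [cZ [phi [psi [[cphi rphi] [cpsi rpsi] phiK psiK]]]]]].
pose c (x : X) (i : 'I_n) : k := if pselect (U0 x) is left h then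
  (val (phi (SigSub (mem_set h))) : 'rV_n) ord0 i else 0.
have cE (u : set_type U0) : c (val u) = (fun i => (val (phi u) : 'rV_n) ord0 i).
  apply/funext => i; rewrite /c; case: pselect => [h|]; last by case; exact: set_valP.
  by congr ((val (phi _) : 'rV_n) ord0 i); exact/val_inj.
have lift (x : X) : U0 x -> exists u : set_type U0, val u = x.
  by move=> Ux; exists (SigSub (mem_set Ux)).
have evE (u : set_type U0) q : mpoly.meval (c (val u)) q = poly_eval q (val (phi u)).
  by rewrite cE.
exists n, c; split=> //.
- move=> q; apply: regular_on_locally => // x /lift[u <-].
  have rq : regular_on setT (fun z : set_type Z => poly_eval q (val z)).
    move=> z _; exists setT, (poly_eval q); split=> //; first exact: openT.
    move=> y _; exists q, 1; rewrite poly_eval1 oner_neq0; split=> // ? _ _.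
    by rewrite poly_eval1 divr1.
  have [V [g [oV Vu rg e]]] := rphi _ _ openT rq u I.
  exists V, g; split=> // y /lift[w <-] Vw; rewrite evE; exact: e.
- move=> W z oW Wz /lift[u uz]; subst z.
  have oW' : open (psi @^-1` ((@set_val _ U0) @^-1` W)).
    move/continuousP: cpsi; apply; by exists W.
  have [O [oO Ou OW]] : exists O : set (affine_space k n),
      [/\ open O, O (val (phi u)) & forall y : set_type Z, O (val y) -> W (val (psi y))].
    move/open_set_typeP : oW' => /(_ (phi u)) [|O [oO Ou OW]].
      by rewrite /preimage/= phiK set_valE.
    by exists O; split=> // y /OW; rewrite /preimage/= set_valE.
  have [q [qu qO]] := oO _ Ou; exists q; rewrite evE; split=> // y /lift[w <-].
  by rewrite evE => /qO/OW; rewrite phiK.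
- move=> U f z oU rf Uz /lift[u uz]; subst z.
  have rfu : regular_on ((@set_val _ U0) @^-1` U) (f \o val : set_type U0 -> k).
    by move=> w Uw; exists U, f; split=> //; move: Uw; rewrite /preimage/= set_valE.
  have oU' : open ((@set_val _ U0) @^-1` U) by exists U.
  have [|O [g [oO Ou rg e]]] := rpsi _ _ oU' rfu (phi u).
    by rewrite /preimage/= phiK set_valE.
  have [a [b [bu ab]]] := rg _ Ou; have [r [ru rO]] := oO _ Ou.
  (* The fraction [a / b] represents [g] only on [O]; the factor [r] confines the nonvanishing locus
     of the denominator to [O]. *)
  exists (a * r), (b * r); rewrite evE poly_evalM mulf_neq0//; split=> // y Uy /lift[w wy].
  subst y; rewrite !evE !poly_evalM mulf_eq0 negb_or => /andP[bw rw].
  have Ow : O (val (phi w)) by exact: rO.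
  have -> : f (val w) = g (val (phi w)).
    rewrite -e//; last by rewrite /preimage/= phiK set_valE.
    by rewrite /= phiK.
  by rewrite ab// mulrA divfK.
- move=> w hw; pose w' : affine_space k n := \row_i w i.
  have evw q : poly_eval q w' = mpoly.meval w q.
    by apply: mpoly.meval_eq => i; rewrite mxE.
  have Zw : Z w'.
    apply: contrapT => nZ; have oZ := closed_openC cZ.
    have [q [qw qZ]] := oZ _ nZ.
    move: qw; rewrite evw hw ?eqxx// => y /lift[u <-]; rewrite evE.
    apply/eqP/negPn/negP => /qZ; apply; exact: set_valP.
  pose u := psi (SigSub (mem_set Zw)).
  exists (val u); split; first exact: set_valP.
  by rewrite cE psiK; apply/funext => i; rewrite /= mxE.
Qed.

End Charts.

(** * Derivations and flat functions *)

Section Derivations.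
Variables (k : closedFieldType) (X : spaceWithFunctions k) (v : vector_field X).
Implicit Types (U V W : set X) (f g : X -> k).

Lemma der_eq U V W f g x : open U -> open V -> open W -> W `<=` U -> W `<=` V ->
  regular_on U f -> regular_on V g -> (forall y, W y -> f y = g y) -> W x ->
  v U f x = v V g x.
Proof.
move=> oU oV oW WU WV rf rg fg Wx.
have rfW : regular_on W f by apply: regular_on_sub rf.
transitivity (v W f x); first exact: (der_restrict v oU oW WU rf rfW).
symmetry; apply: (der_restrict v oV oW WV rg rfW) => // y Wy; by rewrite fg.
Qed.

Lemma der_ext U f g x : open U -> regular_on U f ->
  (forall y, U y -> f y = g y) -> U x -> v U f x = v U g x.
Proof.
move=> oU rf fg Ux; apply: (der_eq oU oU oU) => //.
by apply: eq_regular_on rf _ => // y Uy; rewrite fg.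
Qed.

Lemma derD U f g x : open U -> regular_on U f -> regular_on U g -> U x ->
  v U (fun y => f y + g y) x = v U f x + v U g x.
Proof.
move=> oU rf rg Ux; rewrite -[v U f x]mul1r -der_linear//.
apply: der_ext => // [|y _]; last by rewrite mul1r.
exact: regular_onD.
Qed.

Lemma der_cst U (c : k) x : open U -> U x -> v U (fun=> c) x = 0.
Proof.
move=> oU Ux; have r c' := regular_on_cst U c' oU.
have v0 : v U (fun=> 0) x = 0.
  have := derD oU (r 0) (r 0) Ux; rewrite addr0 => e.
  by apply: (addrI (v U (fun=> 0) x)); rewrite -e addr0.
have v1 : v U (fun=> 1) x = 0.
  have := der_leibniz v oU (r 1) (r 1) Ux; rewrite !mulr1 mul1r => e.
  by apply: (addrI (v U (fun=> 1) x)); rewrite -e addr0.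
have := der_linear v c oU (r 1) (r 0) Ux; by rewrite v0 v1 mulr0 !addr0 mulr1.
Qed.

Lemma derZ U (c : k) f x : open U -> regular_on U f -> U x ->
  v U (fun y => c * f y) x = c * v U f x.
Proof.
move=> oU rf Ux; rewrite der_leibniz//; last exact: regular_on_cst.
by rewrite der_cst// mul0r add0r.
Qed.

Lemma der_sum U n (f : 'I_n -> X -> k) x : open U -> (forall i, regular_on U (f i)) ->
  U x -> v U (fun y => \sum_(i < n) f i y) x = \sum_(i < n) v U (f i) x.
Proof.
move=> oU; elim: n f => [|n IH] f rf Ux.
  rewrite big_ord0 -[RHS](der_cst 0 oU Ux); apply: der_ext => // [|y _].
    exact: regular_on_sum.
  by rewrite big_ord0.
rewrite big_ord_recr/= -IH// -derD//; last exact: regular_on_sum.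
apply: der_ext => // [|y _]; first exact: regular_on_sum.
by rewrite big_ord_recr.
Qed.

Definition itder U n f : X -> k := iter n (v U) f.

Lemma itder_regular U n f : open U -> regular_on U f -> regular_on U (itder U n f).
Proof. by move=> oU rf; elim: n => //= n IH; exact: der_regular. Qed.

Lemma itder_eq U V W n f g x : open U -> open V -> open W -> W `<=` U -> W `<=` V ->
  regular_on U f -> regular_on V g -> (forall y, W y -> f y = g y) -> W x ->
  itder U n f x = itder V n g x.
Proof.
move=> oU oV oW WU WV rf rg fg; elim: n x => [|n IH] x Wx; first exact: fg.
by apply: (der_eq oU oV oW) => //; exact: itder_regular.
Qed.

Lemma itderSr U n f x : itder U n.+1 f x = itder U n (v U f) x.
Proof. by rewrite /itder iterSr. Qed.

Lemma itderD U n f g x : open U -> regular_on U f -> regular_on U g -> U x ->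
  itder U n (fun y => f y + g y) x = itder U n f x + itder U n g x.
Proof.
move=> oU rf rg; elim: n x => // n IH x Ux.
have rfn := itder_regular n oU rf; have rgn := itder_regular n oU rg.
rewrite /= -derD//; apply: der_ext => //.
by apply: itder_regular => //; exact: regular_onD.
Qed.

(* Over the orders of vanishing m and n, only one term of Leibniz' formula survives. *)
Lemma itderM U f g p m n : open U -> regular_on U f -> regular_on U g -> U p ->
  (forall i, (i < m)%N -> itder U i f p = 0) ->
  (forall i, (i < n)%N -> itder U i g p = 0) ->
  itder U (m + n) (fun y => f y * g y) p =
    'C(m + n, m)%:R * (itder U m f p * itder U n g p).
Proof.
move=> oU; move e : (m + n)%N => s; elim: s m n f g e => [|s IH] m n f g e rf rg Up f0 g0.
  by move: e => /eqP; rewrite addn_eq0 => /andP[/eqP-> /eqP->]; rewrite bin0 mul1r.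
have rvf := der_regular v oU rf; have rvg := der_regular v oU rg.
rewrite itderSr (@itder_eq U U U _ _ (fun y => v U f y * g y + f y * v U g y)) //; first last.
- by move=> y Uy; rewrite der_leibniz.
- by apply: regular_onD => //; exact: regular_onM.
- by apply: der_regular => //; exact: regular_onM.
rewrite itderD//; [|exact: regular_onM|exact: regular_onM].
have fE : itder U s (fun y => v U f y * g y) p =
    if m is m'.+1 then 'C(s, m')%:R * (itder U m f p * itder U n g p) else 0.
  case: m e f0 => [|m'] e f0.
    rewrite (IH 0 s)//= ?bin0 ?mul1r ?g0 ?mulr0// -?e//.
    by move=> i ilt; apply: g0; rewrite -[n]add0n e ltnS ltnW.
  move: e; rewrite addSn => -[e]; rewrite (IH m' n)// ?itderSr//.
  by move=> i ilt; rewrite -itderSr f0.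
have gE : itder U s (fun y => f y * v U g y) p =
    if n is n'.+1 then 'C(s, m)%:R * (itder U m f p * itder U n g p) else 0.
  case: n e g0 {fE} => [|n'] e g0.
    rewrite addn0 in e; rewrite (IH s 0)//= ?addn0// ?f0 ?mul0r ?mulr0// ?e//.
    by move=> i ilt; apply: f0; rewrite e ltnS ltnW.
  move: e; rewrite addnS => -[e]; rewrite (IH m n')// ?itderSr//.
  by move=> i ilt; rewrite -itderSr g0.
rewrite {}fE {}gE; case: m e {f0} => [|m'] e; case: n e {g0} => [|n'] e //.
- by rewrite add0r !bin0.
- by rewrite addr0; move: e; rewrite addn0 => -[->]; rewrite !binn.
- by rewrite -mulrDl -natrD binS addnC.
Qed.

(** In characteristic zero the iterated derivatives at [p] are, up to factorials, the Taylor
    coefficients of [f] along the formal integral curve of [v] through [p]; flatness says that [f]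
    vanishes on this curve. *)
Definition flat_at p U f := forall n, itder U n f p = 0.

Lemma flat_eq U V W f g p : open U -> open V -> open W -> W `<=` U -> W `<=` V ->
  regular_on U f -> regular_on V g -> (forall y, W y -> f y = g y) -> W p ->
  flat_at p U f <-> flat_at p V g.
Proof.
move=> oU oV oW WU WV rf rg fg Wp.
have e n : itder U n f p = itder V n g p by exact: (@itder_eq U V W).
by split=> h n; move: (h n); rewrite e.
Qed.

Lemma flat_sub U W f p : open U -> open W -> W `<=` U ->
  regular_on U f -> W p -> flat_at p U f <-> flat_at p W f.
Proof.
move=> oU oW WU rf Wp; apply: (@flat_eq U W W) => //; by apply: regular_on_sub rf.
Qed.

Lemma flat_ext U f g p : open U -> regular_on U f -> (forall y, U y -> f y = g y) ->
  U p -> flat_at p U f -> flat_at p U g.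
Proof.
move=> oU rf fg Up; apply: (proj1 (@flat_eq U U U _ _ _ oU oU oU _ _ rf _ fg Up)) => //.
by apply: eq_regular_on rf _ => // y Uy; rewrite fg.
Qed.

Lemma flat0 U p : open U -> U p -> flat_at p U (fun=> 0).
Proof.
move=> oU Up n; have r := regular_on_cst U (0 : k) oU.
elim: n p Up => // n IH p Up; rewrite -[RHS](der_cst 0 oU Up) /=.
by apply: der_ext => //; exact: itder_regular.
Qed.

Lemma flatD U f g p : open U -> regular_on U f -> regular_on U g -> U p ->
  flat_at p U f -> flat_at p U g -> flat_at p U (fun y => f y + g y).
Proof. by move=> oU rf rg Up ff fg n; rewrite itderD// ff fg addr0. Qed.

Lemma flatM U f g p : open U -> regular_on U f -> regular_on U g -> U p ->
  flat_at p U f -> flat_at p U (fun y => f y * g y).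
Proof.
move=> oU rf rg Up ff n; have := @itderM U f g p n 0 oU rf rg Up.
by rewrite addn0 => ->//; rewrite ff mul0r mulr0.
Qed.

Lemma flat_der U f p : flat_at p U f -> flat_at p U (v U f).
Proof. by move=> ff n; rewrite -itderSr. Qed.

Hypothesis char0 : [pchar k] =i pred0.

(** The lowest nonzero derivatives of [f] and [g], of orders [m] and [n], multiply to a derivative
    of the product of order [m + n], up to a binomial coefficient that is nonzero in characteristic
    zero. *)
Lemma flat_prime U f g p : open U -> regular_on U f -> regular_on U g -> U p ->
  flat_at p U (fun y => f y * g y) -> flat_at p U f \/ flat_at p U g.
Proof.
move=> oU rf rg Up ffg; apply: contrapT => /not_orP[/existsNP nf /existsNP ng].
have first (h : X -> k) : (exists n, itder U n h p <> 0) ->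
    exists n, itder U n h p != 0 /\ forall i, (i < n)%N -> itder U i h p = 0.
  move=> [n /eqP hn]; have ex : exists n, itder U n h p != 0 by exists n.
  case: (ex_minnP ex) => m hm min; exists m; split=> // i im.
  by apply/eqP; apply: contraTT im => /min; rewrite -leqNgt.
have [m [fm fi]] := first _ nf; have [n [gn gi]] := first _ ng.
have /eqP := itderM oU rf rg Up fi gi.
rewrite ffg eq_sym !mulf_eq0 (negPf fm) (negPf gn) !orbF.
by move/pcharf0P: char0 => ->; rewrite eqn0Ngt bin_gt0 leq_addr.
Qed.

End Derivations.

(** * Regular maps and differentiation along the diagonal *)

Lemma open_locally (T : topologicalType) (W : set T) :
  (forall x, W x -> exists V, [/\ open V, V x & V `<=` W]) -> open W.
Proof.
move=> loc; have -> : W = \bigcup_(V in [set V | open V /\ V `<=` W]) V.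
  apply/seteqP; split=> [x /loc[V [oV Vx VW]]|x [V [_ VW]]]; last exact: VW.
  by exists V.
by apply: bigcup_open => V [].
Qed.

Section RegularMaps.
Variable k : closedFieldType.
Implicit Types X Y Z T : spaceWithFunctions k.

Lemma regular_map_open X Y (f : X -> Y) (V : set Y) : regular_map f -> open V ->
  open (f @^-1` V).
Proof. by move=> [/continuousP cf _]; exact: cf. Qed.

Lemma regular_map_on X Y (f : X -> Y) (V : set Y) (g : Y -> k) : regular_map f ->
  open V -> regular_on V g -> regular_on (f @^-1` V) (fun x => g (f x)).
Proof. by move=> [_ rf]; exact: rf. Qed.

Lemma regular_map_id X : regular_map (@idfun X).
Proof. by split=> //; move=> x. Qed.

Lemma regular_map_cst X Y (y : Y) : regular_map (fun _ : X => y).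
Proof.
split; first exact: cst_continuous.
move=> V g oV _; apply: regular_on_cst.
by rewrite /preimage/=; have [Vy|nVy] := pselect (V y);
  [rewrite (_ : [set _ | _] = setT)|rewrite (_ : [set _ | _] = set0)];
  try (by apply/seteqP; split); [exact: openT|exact: open0].
Qed.

Lemma regular_map_comp X Y Z (g : Y -> Z) (f : X -> Y) :
  regular_map g -> regular_map f -> regular_map (g \o f).
Proof.
move=> rg rf; split.
  by move=> x; apply: continuous_comp; [exact: (proj1 rf)|exact: (proj1 rg)].
move=> V h oV rh; apply: (proj2 rf (g @^-1` V) (h \o g)); last exact: (proj2 rg).
exact: regular_map_open rg oV.
Qed.

Lemma regular_tensor T X Y (a : T -> X) (b : T -> Y) (U : set X) (V : set Y) h :
  regular_map a -> regular_map b -> open U -> open V -> tensor_on U V h ->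
  regular_on (a @^-1` U `&` b @^-1` V) (fun t => h (a t, b t)).
Proof.
move=> ra rb oU oV [n [f [g [rf rg e]]]].
have oUa := regular_map_open ra oU; have oVb := regular_map_open rb oV.
have oW : open (a @^-1` U `&` b @^-1` V) by exact: openI.
apply: (@eq_regular_on _ _ _ (fun t => \sum_(i < n) f i (a t) * g i (b t))) => //; last first.
  by move=> t [Ut Vt]; rewrite e.
apply: regular_on_sum => // i; apply: regular_onM => //.
  apply: regular_on_sub (regular_map_on ra oU (rf i)) => //; exact: subIsetl.
apply: regular_on_sub (regular_map_on rb oV (rg i)) => //; exact: subIsetr.
Qed.

(** The universal property of [zprod]. The topology is finer than the product topology, so
    continuity too has to go through the tensors. *)
Lemma regular_map_pair T X Y (a : T -> X) (b : T -> Y) :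
  regular_map a -> regular_map b -> regular_map (fun t => (a t, b t) : zprod X Y).
Proof.
move=> ra rb.
have preo (W : set (zprod X Y)) : open W -> open ((fun t => (a t, b t) : zprod X Y) @^-1` W).
  move=> oW; apply: open_locally => t Wt.
  have [U [V [h [oU oV th [[/= Ut Vt] ht] hW]]]] := oW _ Wt.
  have oUV : open (a @^-1` U `&` b @^-1` V) by apply: openI; exact: regular_map_open.
  exists [set s | (a @^-1` U `&` b @^-1` V) s /\ h (a s, b s) != 0]; split=> //.
    exact: open_regular_neq0 _ _ oUV (regular_tensor ra rb oU oV th).
  by move=> s [[Us Vs] hs]; exact: hW.
split; first by apply/continuousP.
move=> W f oW rf; apply: regular_on_locally; first exact: preo.
move=> t Wt.
have [U [V [h [h' [oU oV [th th'] [[/= Ut Vt] ht] e]]]]] := rf _ Wt.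
have oUV : open (a @^-1` U `&` b @^-1` V) by apply: openI; exact: regular_map_open.
have r := regular_tensor ra rb oU oV th; have r' := regular_tensor ra rb oU oV th'.
have oD := open_regular_neq0 _ _ oUV r'.
exists [set s | (a @^-1` U `&` b @^-1` V) s /\ h' (a s, b s) != 0].
exists (fun s => h (a s, b s) * (h' (a s, b s))^-1); split=> //.
  apply: regular_onM => //; last exact: regular_onV.
  by apply: (regular_on_sub _ _ _ oUV oD _ r) => s [].
by move=> s Ws [[Us Vs] hs] /=; rewrite e.
Qed.

End RegularMaps.

Section DiagonalDerivation.
Variables (k : closedFieldType) (X : spaceWithFunctions k) (v : vector_field X).

(** At a diagonal point both sides of the box shrink to the same open set, so that [v] can act on
    the factors in either variable. *)
Lemma local_tensor (W : set (zprod X X)) G p : open W -> regular_on W G -> W (p, p) ->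
  exists (U : set X) n (f g : 'I_n -> X -> k) m (f' g' : 'I_m -> X -> k),
  let a x y := \sum_(i < n) f i x * g i y in
  let b x y := \sum_(i < m) f' i x * g' i y in
  [/\ open U, U p /\ b p p != 0,
     (forall i, regular_on U (f i)) /\ (forall i, regular_on U (g i)),
     (forall i, regular_on U (f' i)) /\ (forall i, regular_on U (g' i)) &
     forall x y, U x -> U y -> W (x, y) -> b x y != 0 -> G (x, y) * b x y = a x y].
Proof.
move=> oW rG Wp.
have [U [V [a [b [oU oV [ta tb] [[/= Up Vp] bp] e]]]]] := rG _ Wp.
have [n [f [g [rf rg ae]]]] := ta; have [m [f' [g' [rf' rg' be]]]] := tb.
have oUV : open (U `&` V) by exact: openI.
exists (U `&` V), n, f, g, m, f', g'; split=> //.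
- by rewrite -be.
- by split=> i; [apply: (regular_on_sub _ _ _ oU oUV _ (rf i))
                |apply: (regular_on_sub _ _ _ oV oUV _ (rg i))]; move=> ? [].
- by split=> i; [apply: (regular_on_sub _ _ _ oU oUV _ (rf' i))
                |apply: (regular_on_sub _ _ _ oV oUV _ (rg' i))]; move=> ? [].
- move=> x y [Ux _] [_ Vy] Wxy; rewrite -be// -ae// => bxy.
  by rewrite (e (x, y))// divfK.
Qed.

Lemma der_quotient (O : set X) (H B A : X -> k) p : open O ->
  regular_on O H -> regular_on O B -> regular_on O A ->
  (forall x, O x -> B x != 0 -> H x * B x = A x) -> O p -> B p != 0 ->
  v O H p * B p = v O A p - H p * v O B p.
Proof.
move=> oO rH rB rA HBA Op Bp; have oB := open_regular_neq0 _ _ oO rB.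
have BO : [set x | O x /\ B x != 0] `<=` O by move=> ? [].
rewrite -(der_eq v oO oO oB BO BO (regular_onM _ _ _ oO rH rB) rA)//.
  by rewrite der_leibniz// addrK.
by move=> y [Oy By]; exact: HBA.
Qed.

Variables (W : set (zprod X X)) (G : zprod X X -> k).
Hypotheses (oW : open W) (rG : regular_on W G).

Definition slice x : set X := [set y | W (x, y)].
Definition coslice y : set X := [set x | W (x, y)].
Definition diagonal_in : set X := [set x | W (x, x)].

Let rpairl (x : X) := regular_map_pair (regular_map_cst X x) (regular_map_id X).
Let rpairr (x : X) := regular_map_pair (regular_map_id X) (regular_map_cst X x).
Let rdiag := regular_map_pair (regular_map_id X) (regular_map_id X).

Lemma slice_open x : open (slice x).
Proof. exact: (regular_map_open (rpairl x) oW). Qed.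

Lemma coslice_open x : open (coslice x).
Proof. exact: (regular_map_open (rpairr x) oW). Qed.

Lemma diagonal_in_open : open diagonal_in.
Proof. exact: (regular_map_open rdiag oW). Qed.

Lemma slice_regular x : regular_on (slice x) (fun y => G (x, y)).
Proof. exact: (proj2 (rpairl x) _ _ oW rG). Qed.

Lemma coslice_regular y : regular_on (coslice y) (fun x => G (x, y)).
Proof. exact: (proj2 (rpairr y) _ _ oW rG). Qed.

Lemma diagonal_regular : regular_on diagonal_in (fun x => G (x, x)).
Proof. exact: (proj2 rdiag _ _ oW rG). Qed.

(* Differentiating [G * b = a] in the second variable expresses the derivative of G
   by the derivatives of the factors of the tensors a and b. *)
Lemma der_slice_regular :
  regular_on diagonal_in (fun x => v (slice x) (fun y => G (x, y)) x).
Proof.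
apply: regular_on_locally diagonal_in_open _ => p Wp.
have [U [n [f [g [m [f' [g' /= [oU [Up bp] [rf rg] [rf' rg'] e]]]]]]]] := local_tensor oW rG Wp.
set b := fun x y => \sum_(i < m) f' i x * g' i y in bp e.
set a := fun x y => \sum_(i < n) f i x * g i y in e.
have oUD : open (U `&` diagonal_in) by apply: openI => //; exact: diagonal_in_open.
have rs (h : X -> k) : regular_on U h -> regular_on (U `&` diagonal_in) h.
  by apply: regular_on_sub => // x [].
have rb : regular_on (U `&` diagonal_in) (fun x => b x x).
  by apply: regular_on_sum => // i; apply: regular_onM => //; exact: rs.
pose V := [set x | (U `&` diagonal_in) x /\ b x x != 0].
have oV : open V by exact: open_regular_neq0.
have VU : V `<=` (U `&` diagonal_in) by move=> x [].
have rVs (h : X -> k) : regular_on U h -> regular_on V h.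
  by move=> rh; apply: (regular_on_sub _ _ _ oUD oV VU); exact: rs.
exists V, (fun x => ((\sum_(i < n) f i x * v U (g i) x)
   - G (x, x) * (\sum_(i < m) f' i x * v U (g' i) x)) * (b x x)^-1); split=> //.
  apply: regular_onM => //; last exact: regular_onV.
  apply: regular_onB => //.
    apply: regular_on_sum => // i; apply: regular_onM => //; apply: rVs => //.
    exact: der_regular.
  apply: regular_onM => //.
    by apply: (regular_on_sub _ _ _ diagonal_in_open oV _ diagonal_regular) => x [[]].
  by apply: regular_on_sum => // i; apply: regular_onM => //; apply: rVs => //; exact: der_regular.
move=> x Wx [[Ux _] bx]; apply: (mulIf bx); rewrite mulfVK//.
have sum_reg l (h h' : 'I_l -> X -> k) : (forall i, regular_on U (h' i)) ->
    regular_on U (fun y => \sum_(i < l) h i x * h' i y).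
  move=> rh'; apply: regular_on_sum => // i; apply: regular_onM => //; exact: regular_on_cst.
have sum_der l (h h' : 'I_l -> X -> k) : (forall i, regular_on U (h' i)) ->
    v U (fun y => \sum_(i < l) h i x * h' i y) x = \sum_(i < l) h i x * v U (h' i) x.
  move=> rh'; rewrite der_sum//.
    by apply: eq_bigr => i _; rewrite derZ.
  by move=> i; apply: regular_onM => //; exact: regular_on_cst.
have oUx : open (U `&` slice x) by apply: openI => //; exact: slice_open.
have Os : U `&` slice x `<=` slice x by move=> ? [].
have OU : U `&` slice x `<=` U by move=> ? [].
have rO (h : X -> k) : regular_on U h -> regular_on (U `&` slice x) h by exact: regular_on_sub.
have rGx : regular_on (U `&` slice x) (fun y => G (x, y)).
  by apply: (regular_on_sub _ _ _ (slice_open x) oUx Os); exact: slice_regular.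
have rbU := sum_reg _ f' _ rg'; have raU := sum_reg _ f _ rg.
rewrite (der_eq v (slice_open x) oUx oUx Os _ (slice_regular x) rGx)//.
rewrite (der_quotient oUx rGx (rO _ rbU) (rO _ raU))//; last first.
  by move=> y [Uy Wy]; exact: e.
rewrite (der_eq v oUx oU oUx _ OU (rO _ raU) raU)// (der_eq v oUx oU oUx _ OU (rO _ rbU) rbU)//.
by rewrite !sum_der.
Qed.

(** For a tensor this is Leibniz' rule, and the quotient rule carries it over to fractions, being
    linear in the derivatives of numerator and denominator. *)
Lemma der_diagonal p : diagonal_in p ->
  v diagonal_in (fun x => G (x, x)) p =
  v (slice p) (fun y => G (p, y)) p + v (coslice p) (fun x => G (x, p)) p.
Proof.
move=> Wp.
have [U [n [f [g [m [f' [g' /= [oU [Up bp] [rf rg] [rf' rg'] e]]]]]]]] := local_tensor oW rG Wp.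
set b := fun x y => \sum_(i < m) f' i x * g' i y in bp e.
set a := fun x y => \sum_(i < n) f i x * g i y in e.
pose O := U `&` slice p `&` coslice p `&` diagonal_in.
have oO : open O.
  apply: openI diagonal_in_open; apply: openI (coslice_open p).
  exact: openI (slice_open p).
have Op : O p by [].
have OU : O `<=` U by move=> x [[[]]].
have rO (h : X -> k) : regular_on U h -> regular_on O h by exact: regular_on_sub.
have rc c : regular_on O (fun=> c : k) by exact: regular_on_cst.
have rsum l (h h' : 'I_l -> X -> k) : (forall i, regular_on O (h i)) ->
    (forall i, regular_on O (h' i)) -> regular_on O (fun y => \sum_(i < l) h i y * h' i y).
  by move=> rh rh'; apply: regular_on_sum => // i; exact: regular_onM.
have sum_der l (h h' : 'I_l -> X -> k) : (forall i, regular_on U (h i)) ->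
    (forall i, regular_on U (h' i)) ->
    v O (fun y => \sum_(i < l) h i y * h' i y) p =
    v O (fun y => \sum_(i < l) h i p * h' i y) p + v O (fun y => \sum_(i < l) h i y * h' i p) p.
  move=> rh rh'; rewrite !der_sum//; try by move=> i; apply: regular_onM; auto.
  rewrite -big_split; apply: eq_bigr => i _ /=.
  have ? := rO _ (rh i); have ? := rO _ (rh' i).
  by rewrite !der_leibniz// !der_cst// mul0r mulr0 add0r addr0 addrC.
have rd := diagonal_regular; have rs := slice_regular p; have rcs := coslice_regular p.
have Od : O `<=` diagonal_in by move=> ? [].
have Os : O `<=` slice p by move=> ? [[[]]].
have Oc : O `<=` coslice p by move=> ? [[[]]].
have rd' : regular_on O (fun x => G (x, x)) by apply: (regular_on_sub _ _ _ diagonal_in_open oO Od).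
have rs' : regular_on O (fun y => G (p, y)) by apply: (regular_on_sub _ _ _ (slice_open p) oO Os).
have rc' : regular_on O (fun x => G (x, p)) by apply: (regular_on_sub _ _ _ (coslice_open p) oO Oc).
rewrite (der_eq v diagonal_in_open oO oO Od _ rd rd')//.
rewrite (der_eq v (slice_open p) oO oO Os _ rs rs')//.
rewrite (der_eq v (coslice_open p) oO oO Oc _ rcs rc')//.
apply: (mulIf bp); rewrite mulrDl.
rewrite (der_quotient oO (B := fun x => b x x) (A := fun x => a x x))//; first last.
- by move=> x [[[Ux _] _] Wx] bx; exact: e.
- by apply: rsum => i; exact: rO.
- by apply: rsum => i; exact: rO.
rewrite (der_quotient oO (B := fun y => b p y) (A := fun y => a p y))//; first last.
- by move=> x [[[Ux ?] _] _] bx; exact: e.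
- by apply: rsum => i; auto.
- by apply: rsum => i; auto.
rewrite (der_quotient oO (B := fun x => b x p) (A := fun x => a x p))//; first last.
- by move=> x [[[Ux _] ?] _] bx; exact: e.
- by apply: rsum => i; auto.
- by apply: rsum => i; auto.
have -> : v O (fun x => a x x) p = v O (a p) p + v O (a^~ p) p by exact: sum_der.
have -> : v O (fun x => b x x) p = v O (b p) p + v O (b^~ p) p by exact: sum_der.
by rewrite mulrDr opprD addrACA.
Qed.

End DiagonalDerivation.

(** * Regular functions on complete varieties *)

Section GlobalFunctions.
Variable k : closedFieldType.

Lemma regular_map_fst (X Y : spaceWithFunctions k) :
  regular_map (fun p : zprod X Y => p.1).
Proof.
have t1 U : open U -> @tensor_on k X Y U setT (fun=> 1).
  by move=> oU; apply: tensor_on_cst => //; exact: openT.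
split.
  apply/continuousP => U oU; rewrite zprod_openE => p Up; exists U, setT, (fun=> 1).
  by split=> //; [exact: openT|exact: t1|rewrite oner_neq0|move=> q []].
move=> U f oU rf p Up; exists U, setT, (fun q => f q.1), (fun=> 1).
split; [exact: oU|exact: openT| |by rewrite oner_neq0|by move=> q; rewrite divr1].
split; last exact: t1.
exists 1%N, (fun=> f), (fun=> fun=> 1); split=> // [_|x y _ _].
  by apply: regular_on_cst; exact: openT.
by rewrite big_ord1 mulr1.
Qed.

Lemma regular_map_snd (X Y : spaceWithFunctions k) :
  regular_map (fun p : zprod X Y => p.2).
Proof.
have t1 V : open V -> @tensor_on k X Y setT V (fun=> 1).
  by move=> oV; apply: tensor_on_cst => //; exact: openT.
split.
  apply/continuousP => V oV; rewrite zprod_openE => p Vp; exists setT, V, (fun=> 1).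
  by split=> //; [exact: openT|exact: t1|rewrite oner_neq0|move=> q []].
move=> V f oV rf p Vp; exists setT, V, (fun q => f q.2), (fun=> 1).
split; [exact: openT|exact: oV| |by rewrite oner_neq0|by move=> q; rewrite divr1].
split; last exact: t1.
exists 1%N, (fun=> fun=> 1), (fun=> f); split=> // [_|x y _ _].
  by apply: regular_on_cst; exact: openT.
by rewrite big_ord1 mul1r.
Qed.

Lemma closed_regular_eq0 (X : spaceWithFunctions k) (f : X -> k) :
  regular_on setT f -> closed [set x | f x = 0].
Proof.
move=> rf; rewrite -[X in closed X]setCK; apply: open_closedC.
have := open_regular_neq0 _ _ openT rf; congr open.
by apply/seteqP; split=> x /= => [[_ /eqP]//|/eqP].
Qed.

Local Notation A1 := (affine_space k 1).

Definition line_coord (t : A1) : k := (t : 'rV_1) ord0 ord0.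

Lemma line_coord_regular : regular_on setT line_coord.
Proof.
move=> x _; exists (mpoly_var k ord0), 1; rewrite poly_eval1 oner_neq0; split=> // y _ _.
by rewrite poly_eval1 divr1 /poly_eval mpoly.mevalXU.
Qed.

Lemma affine_line_variety : variety A1.
Proof.
split.
  exists 1%N, (fun=> setT); split; last first.
    by apply/seteqP; split=> // x _; exists ord0.
  move=> _; split; first exact: openT.
  exists 1%N, setT; split; first exact: closedT.
  by exists idfun, idfun; split=> //; exact: regular_map_id.
rewrite /separated_space.
have -> : [set p : zprod A1 A1 | p.1 = p.2] =
    [set p | line_coord p.1 - line_coord p.2 = 0].
  apply/seteqP; split=> p /= => [->|/eqP]; first by rewrite subrr.
  rewrite subr_eq0 => /eqP e; apply/rowP => i; rewrite ord1; exact: e.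
apply: closed_regular_eq0; apply: regular_onB; first exact: openT.
  exact: (regular_map_on (regular_map_fst _ _) openT line_coord_regular).
exact: (regular_map_on (regular_map_snd _ _) openT line_coord_regular).
Qed.

(** Each fibre of [f] is open, being the locus where the product of [f - r] over the other possible
    values [r] is nonzero; in an irreducible space two nonempty fibres would meet. *)
Lemma regular_finite_values (X : spaceWithFunctions k) (f : X -> k) (s : seq k) :
  irreducible_space X -> regular_on setT f -> (forall x, f x \in s) ->
  forall x y, f x = f y.
Proof.
move=> irr rf fs x y; apply/eqP/negPn/negP => fxy.
pose W c := [set z | setT z /\ \prod_(r <- s | r != c) (f z - r) != 0].
have oW c : open (W c).
  apply: open_regular_neq0; first exact: openT.
  elim: s {fs W} => [|a s IH].
    apply: (eq_regular_on openT (regular_on_cst setT 1 openT)) => z _.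
    by rewrite big_nil.
  have [->|ac] := eqVneq a c.
    by apply: (eq_regular_on openT IH) => z _; rewrite big_cons eqxx.
  apply: (@eq_regular_on _ _ _ (fun z => (f z - (fun=> a) z) * \prod_(r <- s | r != c) (f z - r))).
  - exact: openT.
  - apply: regular_onM IH; first exact: openT.
    by apply: regular_onB => //; [exact: openT|exact: regular_on_cst openT].
  - by move=> z _; rewrite big_cons ac.
have WE c z : W c z -> f z = c.
  move=> [_]; rewrite prodf_seq_neq0 => /allP/(_ _ (fs z)); rewrite subrr eqxx.
  by case: eqP.
have WI z : W (f z) z.
  split=> //; rewrite prodf_seq_neq0; apply/allP => r _; apply/implyP.
  by rewrite subr_eq0 eq_sym.
have [||||z [/WE fx /WE fy]] := irreducible_meet (U := W (f x)) (V := W (f y)) irr.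
- exact: oW.
- exact: oW.
- by exists x.
- by exists y.
by move: fxy; rewrite -fx -fy eqxx.
Qed.

(* The hyperbola [f(x) t = 1] projects onto a closed subset of the affine line that
   misses 0, hence onto a finite set. *)
Lemma complete_regular_constant (X : spaceWithFunctions k) (f : X -> k) :
  irreducible_space X -> complete_variety X -> regular_on setT f ->
  forall x y, f x = f y.
Proof.
move=> irr comp rf.
pose Z := [set p : zprod X A1 | f p.1 * line_coord p.2 - 1 = 0].
have cZ : closed Z.
  apply: closed_regular_eq0; apply: regular_onB; first exact: openT.
    apply: regular_onM; first exact: openT.
      exact: (regular_map_on (regular_map_fst _ _) openT rf).
    exact: (regular_map_on (regular_map_snd _ _) openT line_coord_regular).
  exact: regular_on_cst openT.
have oS := closed_openC (comp _ affine_line_variety _ cZ).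
pose pt (c : k) : A1 := \row__ c.
have ptE c : line_coord (pt c) = c by rewrite /line_coord mxE.
have nS0 : (~` [set p.2 | p in Z]) (pt 0).
  move=> [p Zp p0]; move: Zp; rewrite /Z /= p0 ptE mulr0 sub0r => /eqP.
  by rewrite oppr_eq0 oner_eq0.
have [q [q0 qS]] := oS _ nS0.
pose Q := mpoly.mmap (@polyC k) (fun _ : 'I_1 => 'X) q.
have QE c : Q.[c] = poly_eval q (pt c).
  rewrite /Q /poly_eval; elim/mpoly_alg_ind: q {q0 qS Q} => [d|i|p p' e e'|p p' e e'].
  - by rewrite mpoly.mmapC mpoly.mevalC hornerC.
  - by rewrite mpoly.mmapX mpoly.mmap1U mpoly.mevalXU hornerX mxE.
  - by rewrite mpoly.mmapD mpoly.mevalD hornerD e e'.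
  - by rewrite rmorphM mpoly.mevalM hornerM e e'.
have Q0 : Q != 0 by apply: contraNneq q0 => Q0; rewrite -QE Q0 horner0.
have [rs Qrs] := closed_field_poly_normal Q.
(* A nonzero value of [f] has its inverse in the projection of the hyperbola, on which [q] vanishes,
   so the inverse is a root of [Q]. *)
apply: (regular_finite_values (s := 0 :: [seq r^-1 | r <- rs])) => // x.
rewrite inE; have [//|fx] := eqVneq (f x) 0; apply/orP; right.
apply/mapP; exists (f x)^-1; last by rewrite invrK.
have : root Q (f x)^-1.
  apply/rootP; rewrite QE; apply/eqP/negPn/negP => /qS; apply.
  by exists (x, pt (f x)^-1) => //=; rewrite /Z/= ptE divff// subrr.
by rewrite Qrs rootZ ?lead_coef_eq0// root_prod_XsubC.
Qed.

End GlobalFunctions.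

(** * Invariance of vector fields *)

Section Translations.
Variables (k : closedFieldType) (A : abelianVariety k).

Lemma regular_mul (T : spaceWithFunctions k) (a b : T -> A) :
  regular_map a -> regular_map b -> regular_map (fun t => (a t * b t)%g).
Proof.
move=> ra rb; exact: (regular_map_comp (@mulg_regular k A) (regular_map_pair ra rb)).
Qed.

Lemma regular_inv (T : spaceWithFunctions k) (a : T -> A) :
  regular_map a -> regular_map (fun t => (a t)^-1%g).
Proof. by move=> ra; exact: (regular_map_comp (@invg_regular k A) ra). Qed.

Lemma regular_mull (a : A) : regular_map (fun x => (a * x)%g).
Proof. exact: regular_mul (regular_map_cst _ _) (regular_map_id _). Qed.

Definition ltrans (a : A) (U : set A) : set A := [set x | U (a * x)%g].

Lemma ltrans_open a U : open U -> open (ltrans a U).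
Proof. exact: regular_map_open (regular_mull a). Qed.

Lemma ltrans_regular a U f : open U -> regular_on U f ->
  regular_on (ltrans a U) (fun x => f (a * x)%g).
Proof. exact: regular_map_on (regular_mull a). Qed.

Definition sinv (U : set A) : set A := [set x | U x^-1%g].

Lemma sinv_open U : open U -> open (sinv U).
Proof. exact: regular_map_open (@invg_regular k A). Qed.

Lemma sinv_regular U f : open U -> regular_on U f ->
  regular_on (sinv U) (fun x => f x^-1%g).
Proof. exact: regular_map_on (@invg_regular k A). Qed.

Lemma sinvK U : sinv (sinv U) = U.
Proof. by apply/seteqP; split=> x; rewrite /sinv/= invgK. Qed.

(* The derivative at x of the translate [y |-> f (x^-1 * y)] is a regular function of
   x in A, hence constant. *)
Lemma der_ltrans1 (v : vector_field A) (V : set A) g x : open V -> regular_on V g -> V x ->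
  v V g x = v (ltrans x V) (fun y => g (x * y)%g) 1%g.
Proof.
move=> oV rg Vx.
pose m (p : zprod A A) : A := (p.1^-1 * p.2)%g.
have rm : regular_map m.
  exact: regular_mul (regular_inv (regular_map_fst _ _)) (regular_map_snd _ _).
pose U := ltrans x V; pose f y := g (x * y)%g.
have oU : open U by exact: ltrans_open.
have rf : regular_on U f by exact: ltrans_regular.
have U1 : U 1%g by rewrite /U /ltrans/= mulg1.
pose W := m @^-1` U; pose G := f \o m.
have oW : open W by exact: regular_map_open rm oU.
have rG : regular_on W G by exact: (regular_map_on rm oU rf).
have rphi := der_slice_regular v oW rG.
(* The map [m] sends the whole diagonal to 1, which lies in [U]; hence the derivative along the
   diagonal is defined on all of [A]. *)
have dT : diagonal_in W = setT.
  by apply/seteqP; split=> // y _; rewrite /diagonal_in /W /m /preimage/= mulVg.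
rewrite dT in rphi.
have := complete_regular_constant (abelian_variety_irreducible (s := A))
  (abelian_variety_complete (s := A)) rphi x 1%g.
have -> : slice W x = V.
  by apply/seteqP; split=> y; rewrite /slice /W /m /U /ltrans /preimage/= mulVKg.
have -> : slice W 1%g = U.
  by apply/seteqP; split=> y; rewrite /slice /W /m /preimage/= invg1 mul1g.
have -> : (fun y => G (x, y)) = g.
  by apply/funext => y; rewrite /G /m /f/= mulVKg.
have -> // : (fun y => G (1%g, y)) = f.
by apply/funext => y; rewrite /G /m/= invg1 mul1g.
Qed.

(** Both sides are the derivative at 1 of the same translate of [g]. *)
Lemma der_ltrans (v : vector_field A) (V : set A) g a x : open V -> regular_on V g ->
  V (a * x)%g -> v V g (a * x)%g = v (ltrans a V) (fun y => g (a * y)%g) x.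
Proof.
move=> oV rg Vax; have oV' := ltrans_open a oV.
rewrite der_ltrans1// [RHS]der_ltrans1//; last exact: ltrans_regular.
have -> : ltrans x (ltrans a V) = ltrans (a * x)%g V.
  by apply/seteqP; split=> y; rewrite /ltrans/= mulgA.
by congr (v _ _ _); apply/funext => y; rewrite mulgA.
Qed.

Lemma itder_ltrans (v : vector_field A) (V : set A) n g a x : open V -> regular_on V g ->
  V (a * x)%g ->
  itder v V n g (a * x)%g = itder v (ltrans a V) n (fun y => g (a * y)%g) x.
Proof.
move=> oV rg; elim: n x => // n IH x Vax /=.
have rn := itder_regular v n oV rg.
rewrite der_ltrans//; apply: der_ext => //; first exact: ltrans_open.
exact: ltrans_regular.
Qed.

(** * The push-forward of a vector field under the inverse map *)

Section InverseField.
Variable v : vector_field A.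

Definition inv_der (U : set A) (f : A -> k) (x : A) : k :=
  v (sinv U) (fun y => f y^-1%g) x^-1%g.

Fact inv_der_regular U f : open U -> regular_on U f -> regular_on U (inv_der U f).
Proof.
move=> oU rf; rewrite -{1}[U]sinvK; apply: sinv_regular; first exact: sinv_open.
by apply: der_regular; [exact: sinv_open|exact: sinv_regular].
Qed.

Fact inv_der_restrict (U V : set A) (f g : A -> k) : open U -> open V ->
  V `<=` U -> regular_on U f -> regular_on V g ->
  (forall x, V x -> f x = g x) -> forall x, V x -> inv_der U f x = inv_der V g x.
Proof.
move=> oU oV VU rf rg fg x Vx.
apply: (der_restrict v (sinv_open oU) (sinv_open oV)).
- by move=> y; exact: VU.
- exact: sinv_regular.
- exact: sinv_regular.
- by move=> y Vy; exact: fg.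
- by rewrite /sinv/= invgK.
Qed.

Fact inv_der_linear (U : set A) (c : k) (f g : A -> k) : open U ->
  regular_on U f -> regular_on U g ->
  forall x, U x -> inv_der U (fun y => c * f y + g y) x = c * inv_der U f x + inv_der U g x.
Proof.
move=> oU rf rg x Ux; apply: (der_linear v c (sinv_open oU)); try exact: sinv_regular.
by rewrite /sinv/= invgK.
Qed.

Fact inv_der_leibniz (U : set A) (f g : A -> k) : open U ->
  regular_on U f -> regular_on U g ->
  forall x, U x -> inv_der U (fun y => f y * g y) x = inv_der U f x * g x + f x * inv_der U g x.
Proof.
move=> oU rf rg x Ux; rewrite /inv_der (der_leibniz v (sinv_open oU)) ?invgK//;
  try exact: sinv_regular.
by rewrite /sinv/= invgK.
Qed.

(** As a vector field it is itself subject to [der_ltrans1], so its comparison with [-v] reduces to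
    the point 1. *)
Definition inv_field : vector_field A :=
  VectorField inv_der_regular inv_der_restrict inv_der_linear inv_der_leibniz.

(** The function [f (x * y^-1)] is constant on the diagonal, so its partial derivatives at [(1, 1)]
    add up to zero by [der_diagonal]. *)
Lemma der_sinv1 U f : open U -> regular_on U f -> U 1%g ->
  v (sinv U) (fun y => f y^-1%g) 1%g = - v U f 1%g.
Proof.
move=> oU rf U1.
pose m (p : zprod A A) : A := (p.1 * p.2^-1)%g.
have rm : regular_map m.
  exact: regular_mul (regular_map_fst _ _) (regular_inv (regular_map_snd _ _)).
pose W := m @^-1` U; pose G := f \o m.
have oW : open W by exact: regular_map_open rm oU.
have rG : regular_on W G by exact: (regular_map_on rm oU rf).
have dT : diagonal_in W = setT.
  by apply/seteqP; split=> // y _; rewrite /diagonal_in /W /m /preimage/= mulgV.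
have W1 : diagonal_in W 1%g by rewrite dT.
have := der_diagonal v oW rG W1; rewrite dT.
have -> : slice W 1%g = sinv U.
  by apply/seteqP; split=> y; rewrite /slice /W /m /preimage/= mul1g.
have -> : coslice W 1%g = U.
  by apply/seteqP; split=> y; rewrite /coslice /W /m /preimage/= invg1 mulg1.
have -> : (fun x => G (x, x)) = (fun=> f 1%g).
  by apply/funext => y; rewrite /G /m/= mulgV.
have -> : (fun y => G (1%g, y)) = (fun y => f y^-1%g).
  by apply/funext => y; rewrite /G /m/= mul1g.
have -> : (fun y => G (y, 1%g)) = f.
  by apply/funext => y; rewrite /G /m/= invg1 mulg1.
rewrite der_cst//; last exact: openT.
by move=> /esym/eqP; rewrite addr_eq0 => /eqP.
Qed.

Lemma der_sinv U f x : open U -> regular_on U f -> U x ->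
  v (sinv U) (fun y => f y^-1%g) x^-1%g = - v U f x.
Proof.
move=> oU rf Ux; rewrite -[LHS]/(inv_field U f x) (der_ltrans1 inv_field)//.
have oU' := ltrans_open x oU; have rf' := ltrans_regular x oU rf.
have U1 : ltrans x U 1%g by rewrite /ltrans/= mulg1.
rewrite (der_ltrans1 v oU rf Ux) -(der_sinv1 oU' rf' U1).
by rewrite -[LHS]/(v _ _ (1^-1)%g) invg1.
Qed.

Lemma itder_sinv U n f x : open U -> regular_on U f -> U x ->
  itder v (sinv U) n (fun y => f y^-1%g) x^-1%g = (-1) ^+ n * itder v U n f x.
Proof.
move=> oU rf; have oU' := sinv_open oU.
elim: n x => [|n IH] x Ux; first by rewrite /= invgK mul1r.
have rn := itder_regular v n oU rf.
have e y : sinv U y -> itder v (sinv U) n (fun y => f y^-1%g) y =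
    (fun y => (-1) ^+ n * itder v U n f y^-1%g) y.
  by move=> Uy; rewrite -{1}[y]invgK IH.
rewrite [itder v _ n.+1 _]/itder/= -/(itder v _ n _).
rewrite (der_ext v oU' _ e); first last.
- by rewrite /sinv/= invgK.
- by apply: itder_regular => //; exact: sinv_regular.
rewrite derZ//; last 2 first.
- exact: sinv_regular.
- by rewrite /sinv/= invgK.
by rewrite der_sinv//= exprSr mulrN1 mulNr mulrN.
Qed.

End InverseField.
End Translations.

(** * Orbit closures *)

Section Orbits.
Variables (k : closedFieldType) (char0 : [pchar k] =i pred0).
Variables (A : abelianVariety k) (v : vector_field A).

(* The generic point of the closure of the formal orbit of p lies in the interior of W. *)
Definition orbit_meets (p : A) (W : set A) : Prop :=
  exists (U : set A) (f : A -> k), [/\ open U, U p, regular_on U f, ~ flat_at v p U f &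
    forall x, U x -> f x != 0 -> W x].

Lemma not_flat_neq0 p U f : f p != 0 -> ~ flat_at v p U f.
Proof. by move=> /eqP fp /(_ 0%N). Qed.

Lemma orbit_meets_sub p (W W' : set A) : W `<=` W' -> orbit_meets p W -> orbit_meets p W'.
Proof.
move=> WW' [U [f [oU Up rf nf fW]]]; exists U, f; split=> // x Ux fx.
by apply: WW'; exact: fW.
Qed.

Lemma orbit_meets_open p (W : set A) : open W -> W p -> orbit_meets p W.
Proof.
move=> oW Wp; exists W, (fun=> 1); split=> //; first exact: regular_on_cst.
by apply: not_flat_neq0; rewrite oner_neq0.
Qed.

(** The filter property rests on [flat_prime]: the product of the two witnesses is again not
    flat. *)
Lemma orbit_meetsI p (W W' : set A) :
  orbit_meets p W -> orbit_meets p W' -> orbit_meets p (W `&` W').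
Proof.
move=> [U [f [oU Up rf nf fW]]] [U' [f' [oU' Up' rf' nf' fW']]].
have oUU : open (U `&` U') by exact: openI.
have UUp : (U `&` U') p by [].
have rfU : regular_on (U `&` U') f by exact: regular_on_sub oU oUU (@subIsetl _ _ _) rf.
have rfU' : regular_on (U `&` U') f' by exact: regular_on_sub oU' oUU (@subIsetr _ _ _) rf'.
exists (U `&` U'), (fun x => f x * f' x); split=> //; first exact: regular_onM.
  move=> /(flat_prime char0 oUU rfU rfU' UUp)[].
    by move/(flat_sub v oU oUU (@subIsetl _ _ _) rf UUp).
  by move/(flat_sub v oU' oUU (@subIsetr _ _ _) rf' UUp).
by move=> x [Ux Ux']; rewrite mulf_eq0 negb_or => /andP[fx fx']; split; [exact: fW|exact: fW'].
Qed.

Lemma orbit_meets_ltrans a x (W : set A) :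
  orbit_meets x W -> orbit_meets (a * x)%g (ltrans a^-1%g W).
Proof.
move=> [U [f [oU Ux rf nf fW]]].
exists (ltrans a^-1%g U), (fun y => f (a^-1 * y)%g); split.
- exact: ltrans_open.
- by rewrite /ltrans/= mulKg.
- exact: ltrans_regular.
- apply: contra_not nf => nf n; rewrite -[x](mulKg a) itder_ltrans// mulKg//.
- by move=> y Uy fy; exact: fW.
Qed.

Lemma orbit_meets_sinv (W : set A) : orbit_meets 1%g W -> orbit_meets 1%g (sinv W).
Proof.
move=> [U [f [oU U1 rf nf fW]]].
exists (sinv U), (fun y => f y^-1%g); split.
- exact: sinv_open.
- by rewrite /sinv/= invg1.
- exact: sinv_regular.
- apply: contra_not nf => nf n; have := itder_sinv v n oU rf U1.
  by rewrite invg1 nf => /eqP; rewrite eq_sym mulf_eq0 signr_eq0/= => /eqP.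
- by move=> y Uy fy; exact: fW.
Qed.

(** The specializations of the generic point of the formal orbit of 1. Neighbourhoods are used
    because [z] and 1 need not lie in a common chart. *)
Definition orbit_closure : set A :=
  [set z | forall W : set A, open W -> W z -> orbit_meets 1%g W].

Lemma orbit_closure_closed : closed orbit_closure.
Proof.
rewrite -[X in closed X]setCK; apply: open_closedC; apply: open_locally => z /existsNP[W].
move=> /not_implyP[oW /not_implyP[Wz nW]]; exists W; split=> // y Wy Zy.
by apply: nW; exact: Zy.
Qed.

Lemma orbit_closure1 : orbit_closure 1%g.
Proof. by move=> W oW W1; exact: orbit_meets_open. Qed.

Lemma orbit_closureV x : orbit_closure x -> orbit_closure x^-1%g.
Proof.
move=> Zx W oW Wx; rewrite -[W]sinvK; apply: orbit_meets_sinv.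
by apply: Zx => //; exact: sinv_open.
Qed.

(** * Orbit closures in coordinates around 1 *)

Section Chart.
Variables (U0 : set A) (n : nat) (c : A -> 'I_n -> k).
Hypotheses (chartU0 : affine_chart U0 c) (U01 : U0 1%g).
Local Notation ev q := (fun x => mpoly.meval (c x) q).

Let oU0 : open U0 := chart_open chartU0.
Let irrA : irreducible_space A := abelian_variety_irreducible (s := A).

Lemma evM p q x : ev (p * q) x = ev p x * ev q x.
Proof. exact: mpoly.mevalM. Qed.

Definition orbit_ideal : set (mpoly.mpoly n k) := [set q | flat_at v 1%g U0 (ev q)].

Lemma orbit_ideal_prime : prime_ideal orbit_ideal.
Proof.
have r q : regular_on U0 (ev q) by exact: (chart_regular chartU0).
split.
- by apply: (flat_ext oU0 _ _ U01 (flat0 v oU0 U01)) => [|y _];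
    [exact: regular_on_cst|rewrite mpoly.meval0].
- move=> f g ff fg; apply: (flat_ext oU0 _ _ U01 (flatD oU0 (r f) (r g) U01 ff fg)).
    exact: regular_onD.
  by move=> x _; rewrite mpoly.mevalD.
- move=> f g fg; apply: (flat_ext oU0 _ _ U01 (flatM oU0 (r g) (r f) U01 fg)).
    exact: regular_onM.
  by move=> x _; rewrite evM mulrC.
- by apply: not_flat_neq0; rewrite mpoly.meval1 oner_neq0.
- move=> f g ffg; apply: (flat_prime char0 oU0 (r f) (r g) U01).
  by apply: flat_ext ffg => // x _; rewrite evM.
Qed.

(* The Nullstellensatz turns a neighbourhood of the generic point of the orbit into an
   actual point. *)
Lemma orbit_meets_point (W : set A) : orbit_meets 1%g W -> exists z,
  [/\ U0 z, W z & forall q, orbit_ideal q -> ev q z = 0].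
Proof.
move=> [U [f [oU U1 rf nf fW]]].
have [_ _ _ _ PP] := orbit_ideal_prime.
have [a [b [b1 fba]]] := chart_fraction chartU0 oU rf U1 U01.
have [r [r1 rU]] := chart_basis chartU0 oU U1 U01.
have rev q : regular_on U0 (ev q) by exact: (chart_regular chartU0).
have na : ~ orbit_ideal a.
  have oUU : open (U `&` U0) by exact: openI.
  have rb : regular_on (U `&` U0) (ev b).
    exact: regular_on_sub oU0 oUU (@subIsetr _ _ _) (rev b).
  pose O := [set x | (U `&` U0) x /\ ev b x != 0].
  have oO : open O by exact: open_regular_neq0.
  have O1 : O 1%g by [].
  have OU : O `<=` U by move=> ? [[]].
  have OU0 : O `<=` U0 by move=> ? [[]].
  have rfO : regular_on O f by exact: regular_on_sub oU oO OU rf.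
  have rbO : regular_on O (ev b) by exact: regular_on_sub oU0 oO OU0 (rev b).
  move=> fa.
  have : flat_at v 1%g O (fun x => f x * ev b x).
    apply/(@flat_eq _ _ v O U0 O _ (ev a)) => //; first exact: regular_onM.
    by move=> y [[Uy U0y] by0]; exact: fba.
  move=> /(flat_prime char0 oO rfO rbO O1)[]; last exact: not_flat_neq0.
  by move/(flat_sub v oU oO OU rf O1).
(* At a zero of the ideal where this product is nonzero, [r] ensures membership in [U], [b] makes
   the fraction compute [f], and [a] makes [f] nonzero. *)
have nabr : ~ orbit_ideal (a * b * r).
  move=> /PP[/PP[//|]|]; exact: not_flat_neq0.
have [w [wP wabr]] := nullstellensatz orbit_ideal_prime nabr.
have [z [U0z czw]] : exists z, U0 z /\ c z = w.
  apply: (chart_closed chartU0) => q q0; apply: wP.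
  apply: (flat_ext oU0 _ _ U01 (flat0 v oU0 U01)) => [|y Uy]; last by rewrite q0.
  exact: regular_on_cst.
exists z; rewrite czw; split=> //.
move: wabr; rewrite !mpoly.mevalM !mulf_eq0 !negb_or => /andP[/andP[az bz] rz].
have Uz : U z by apply: rU; rewrite ?czw.
apply: fW => //; apply: contraNneq az => fz.
by have := fba z Uz U0z; rewrite czw fz mul0r => <-.
Qed.

Lemma orbit_ideal_closure z : U0 z -> (forall q, orbit_ideal q -> ev q z = 0) ->
  orbit_closure z.
Proof.
move=> U0z qz W oW Wz; have [q [q0 qW]] := chart_basis chartU0 oW Wz U0z.
exists U0, (ev q); split=> //; first exact: (chart_regular chartU0).
by move=> /qz /eqP; rewrite (negPf q0).
Qed.

(** Irreducibility of [A] extends the relation across the zeros of [b]. This matters because a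
    denominator chosen at [z] may vanish at 1. *)
Lemma chart_fraction_dense U f z : open U -> regular_on U f -> U z -> U0 z ->
  exists a b, ev b z != 0 /\ forall y, U y -> U0 y -> f y * ev b y = ev a y.
Proof.
move=> oU rf Uz U0z; have [a [b [bz fba]]] := chart_fraction chartU0 oU rf Uz U0z.
exists a, b; split=> // y Uy U0y.
have rev q : regular_on U0 (ev q) by exact: (chart_regular chartU0).
have oUU : open (U `&` U0) by exact: openI.
have subl := @subIsetl _ U U0; have subr := @subIsetr _ U U0.
have rb : regular_on (U `&` U0) (ev b) by exact: regular_on_sub oU0 oUU subr (rev b).
have ra : regular_on (U `&` U0) (ev a) by exact: regular_on_sub oU0 oUU subr (rev a).
have rfU : regular_on (U `&` U0) f by exact: regular_on_sub oU oUU subl rf.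
have oO := open_regular_neq0 _ _ oUU rb.
apply/eqP; rewrite -subr_eq0; apply/eqP.
apply: (regular_on_dense irrA oUU oO (f := fun x => f x * ev b x - ev a x)) => //.
- by apply: regular_onB => //; exact: regular_onM.
- by exists z; split.
- by move=> x _ [[Ux U0x] bx]; rewrite fba// subrr.
Qed.

(** A factor that is nonzero at [z] affects flatness in neither direction: [flatM] multiplies by it
    and [flat_prime] cancels it. *)
Lemma flat_fraction U f a b z : open U -> regular_on U f -> U z -> U0 z ->
  (forall y, U y -> U0 y -> f y * ev b y = ev a y) -> ev b z != 0 ->
  flat_at v z U f <-> flat_at v z U0 (ev a).
Proof.
move=> oU rf Uz U0z fba bz.
have rev q : regular_on U0 (ev q) by exact: (chart_regular chartU0).
have oUU : open (U `&` U0) by exact: openI.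
have UUz : (U `&` U0) z by [].
have subl := @subIsetl _ U U0; have subr := @subIsetr _ U U0.
have rb : regular_on (U `&` U0) (ev b) by exact: regular_on_sub oU0 oUU subr (rev b).
have ra : regular_on (U `&` U0) (ev a) by exact: regular_on_sub oU0 oUU subr (rev a).
have rfU : regular_on (U `&` U0) f by exact: regular_on_sub oU oUU subl rf.
have rfb : regular_on (U `&` U0) (fun x => f x * ev b x) by exact: regular_onM.
have e : flat_at v z (U `&` U0) (fun x => f x * ev b x) <-> flat_at v z (U `&` U0) (ev a).
  by apply: (@flat_eq _ _ v _ _ (U `&` U0)) => // y [Uy U0y]; exact: fba.
split=> [ff|fa].
  apply/(flat_sub v oU0 oUU subr (rev a) UUz)/e; apply: flatM => //.
  exact/(flat_sub v oU oUU subl rf UUz).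
apply/(flat_sub v oU oUU subl rf UUz).
have /e/(flat_prime char0 oUU rfU rb UUz)[//|fb] : flat_at v z (U `&` U0) (ev a).
  exact/(flat_sub v oU0 oUU subr (rev a) UUz).
by exfalso; exact: not_flat_neq0 fb.
Qed.

(** The witness inside [orbit_meets] is some other function, so a closed point is needed: there [h]
    is nonzero, whereas if [h] were flat at 1, so would be its numerator [a], which would then
    vanish at that point. *)
Lemma orbit_meets_not_flat h : regular_on U0 h ->
  orbit_meets 1%g [set x | U0 x /\ h x != 0] -> ~ flat_at v 1%g U0 h.
Proof.
move=> rh /orbit_meets_point[z [U0z [_ hz] Pz]] fh.
have rev q : regular_on U0 (ev q) by exact: (chart_regular chartU0).
have [a [b [bz hba]]] := chart_fraction_dense oU0 rh U0z U0z.
have Pa : orbit_ideal a.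
  apply: (proj1 (flat_eq v oU0 oU0 oU0 _ _ (regular_onM _ _ _ oU0 rh (rev b)) (rev a) _ U01)) => //.
    by move=> y Uy; exact: hba.
  exact: flatM.
have /eqP := hba z U0z U0z; rewrite (Pz a Pa).
by rewrite mulf_eq0 (negPf hz) (negPf bz).
Qed.

(** Transitivity: the orbit closure of a point of [orbit_closure] stays inside it. *)
Lemma orbit_closure_meets x (W : set A) :
  orbit_closure x -> orbit_meets x W -> orbit_meets 1%g W.
Proof.
move=> Zx [U [f [oU Ux rf nf fW]]].
have [m /eqP fm] : exists m, itder v U m f x <> 0 by apply/existsNP.
have rfm := itder_regular v m oU rf.
have rev q : regular_on U0 (ev q) by exact: (chart_regular chartU0).
have oU' := open_regular_neq0 _ _ oU rfm.
(* Since [x] may lie outside the chart, it is traded for a point [z] of the chart where the same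
   derivative of [f] is nonzero; there non-flatness passes from [f] to its numerator [a], and from
   [z] on to 1. *)
have [z [U0z [Uz fz] Pz]] := orbit_meets_point (Zx _ oU' (conj Ux fm)).
have [a [b [bz fba]]] := chart_fraction_dense oU rf Uz U0z.
have [j /eqP aj] : exists j, itder v U0 j (ev a) z <> 0.
  apply/existsNP => /(flat_fraction oU rf Uz U0z fba bz) /(_ m) fm0.
  by rewrite fm0 eqxx in fz.
have raj := itder_regular v j oU0 (rev a).
have /(orbit_meets_not_flat raj) naj : orbit_meets 1%g [set y | U0 y /\ itder v U0 j (ev a) y != 0].
  by apply: (orbit_ideal_closure U0z Pz) => //; exact: open_regular_neq0.
have na : ~ flat_at v 1%g U0 (ev a).
  by move=> fa; apply: naj; elim: j {aj raj} => //= j; exact: flat_der.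
have m1 : orbit_meets 1%g (U `&` [set y | U0 y /\ ev a y != 0]).
  by apply: orbit_meetsI; [exact: Zx|exists U0, (ev a)].
apply: orbit_meets_sub m1 => y [Uy [U0y ay]]; apply: fW => //.
by apply: contraNneq ay => f0; rewrite -fba// f0 mul0r.
Qed.

End Chart.

Lemma chart_at1 : exists (U0 : set A) n (c : A -> 'I_n -> k), affine_chart U0 c /\ U0 1%g.
Proof.
have [[m [U [UP cov]]] _] := abelian_variety_variety (s := A).
have : (\bigcup_(i in [set: 'I_m]) U i) 1%g by rewrite cov.
move=> [i _ Ui]; have [oU aU] := UP i.
by have [n [c chart]] := affine_variety_chart oU aU; exists (U i), n, c.
Qed.

Lemma orbit_closure_point (W : set A) : orbit_meets 1%g W -> (orbit_closure `&` W) !=set0.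
Proof.
have [U0 [n [c [chart U01]]]] := chart_at1.
move=> /(orbit_meets_point chart U01)[z [U0z Wz Pz]]; exists z; split=> //.
exact: (orbit_ideal_closure chart U01 U0z Pz).
Qed.

Lemma orbit_closureM x y : orbit_closure x -> orbit_closure y -> orbit_closure (x * y)%g.
Proof.
have [U0 [n [c [chart U01]]]] := chart_at1.
move=> Zx Zy W oW Wxy; apply: (orbit_closure_meets chart U01 Zx).
have := orbit_meets_ltrans x (Zy _ (ltrans_open x oW) Wxy); rewrite mulg1.
by apply: orbit_meets_sub => z; rewrite /ltrans/= mulVKg.
Qed.

(** The complements of two proper closed subsets both contain the generic point, so by
    [orbit_meetsI] and [orbit_closure_point] they share a closed point. *)
Lemma orbit_closure_irreducible : irreducible_space (set_type orbit_closure).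
Proof.
split; first by exists (SigSub (mem_set orbit_closure1)).
move=> F G cF cG FG; apply: contrapT => /not_orP[nF nG].
have ex (H : set (set_type orbit_closure)) : closed H -> H <> setT ->
    exists2 W : set A, orbit_meets 1%g W & forall z, W (val z) -> ~ H z.
  move=> /closed_openC/open_set_typeP oH nH.
  have [z Hz] : exists z, ~ H z by apply/existsNP => h; apply: nH; apply/seteqP; split.
  have [W [oW Wz WH]] := oH _ Hz; exists W => //.
  exact: (set_valP z).
have [W mW WF] := ex _ cF nF; have [W' mW' WG] := ex _ cG nG.
have [z [Zz [Wz Wz']]] := orbit_closure_point (orbit_meetsI mW mW').
have : (F `|` G) (SigSub (mem_set Zz)) by rewrite FG.
by case; [apply: WF|apply: WG].
Qed.

Lemma orbit_closure_abelian_subvariety : abelian_subvariety orbit_closure.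
Proof.
split.
- exact: orbit_closure_closed.
- exact: orbit_closure_irreducible.
- exact: orbit_closure1.
- exact: orbit_closureM.
- exact: orbit_closureV.
Qed.

Lemma orbit_closure_neq1 : nontrivial_field v -> orbit_closure <> [set 1%g].
Proof.
move=> [U [f [x [oU rf Ux vfx]]]] Z1.
have oU' := ltrans_open x oU; have rf' := ltrans_regular x oU rf.
(* The function [g] vanishes at 1 but its first derivative there is [v U f x], so [g] is nonzero at
   some point of the orbit closure, which cannot be 1. *)
pose V := ltrans x U; pose g y := f (x * y)%g - f x.
have V1 : V 1%g by rewrite /V /ltrans/= mulg1.
have rg : regular_on V g by apply: regular_onB => //; exact: regular_on_cst.
have : orbit_meets 1%g [set y | V y /\ g y != 0].
  exists V, g; split=> // /(_ 1%N) /=.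
  have rn1 : regular_on V (fun=> -1 * f x) by exact: regular_on_cst.
  rewrite (der_ext v oU' rg (g := fun y => f (x * y)%g + (fun=> -1 * f x) y))//; last first.
    by move=> y _; rewrite /g mulN1r.
  by rewrite derD// der_cst// addr0 -der_ltrans1// => /eqP; apply/negP.
move=> /orbit_closure_point[y []]; rewrite Z1 => -> [_].
by rewrite /g mulg1 subrr eqxx.
Qed.

Lemma invariant_flat (Y U : set A) f : invariant_set v Y -> open U -> regular_on U f ->
  (forall x, U x -> Y x -> f x = 0) -> forall x, U x -> Y x -> flat_at v x U f.
Proof.
move=> invY oU rf f0 x Ux Yx n; elim: n x Ux Yx => // n IH x Ux Yx.
by apply: invY => //; exact: itder_regular.
Qed.

End Orbits.

Theorem proposition5p1 (k : closedFieldType) (k_char0 : [pchar k] =i pred0)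
    (A : abelianVariety k) (A_simple : simple_abelian A)
    (v : vector_field A) (v_nontrivial : nontrivial_field v) :
  wild v.
Proof.
move=> [Y [cY [y Yy] YT invY]].
have [|ZT] := proj2 A_simple _ (orbit_closure_abelian_subvariety k_char0 v).
  exact: orbit_closure_neq1.
have [w nYw] : exists w, ~ Y w.
  by apply/existsNP => h; move/eqP: YT; apply; apply/seteqP; split.
have oW := closed_openC cY.
(* Translation by [y] takes the orbit of 1 near [y^-1 * w] to the orbit of [y] near [w]. The
   resulting [f] is not flat at [y], yet it vanishes on [Y], because its nonvanishing locus lies in
   the complement. *)
have : orbit_closure v (y^-1 * w)%g by rewrite ZT.
move=> /(_ _ (ltrans_open y oW)); rewrite /ltrans/= mulVKg => /(_ nYw).
move=> /(orbit_meets_ltrans y); rewrite mulg1 => -[U [f [oU Uy rf nf fW]]].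
apply: nf; apply: (invariant_flat invY oU rf) => // x Ux Yx.
apply/eqP/negPn/negP => /(fW x Ux); rewrite /ltrans/= mulVKg; exact.
Qed.
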